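(* There exists a constant $c<\infty$ such that, for any $L,K\in 2\mathbb{N}\cup\{1\}$ satisfying $K\le\sqrt{\log L}$, $$\sum_{x\in\mathbb{S}_{L,K}}\frac{\mathcal{C}_{L,K}(o,x)}{|\mathbb{S}_{L,K}|}\;\le\; c\,\sqrt{\frac{K}{\log L}}.$$
   Context: $\mathbb{N}=\{1,2,\dots\}$. For $L,K\in 2\mathbb{N}\cup\{1\}$ the slab torus $\mathbb{S}_{L,K}$ is the graph with vertex set $\big((-\tfrac L2,\tfrac L2]\cap\mathbb{Z}\big)^2\times\big((-\tfrac K2,\tfrac K2]\cap\mathbb{Z}\big)$ with nearest-neighbour edges and periodic boundary conditions: two distinct vertices are joined by an edge iff they differ by $\pm e_i$ for some Cartesian vector $e_i$, $i\in\{1,2,3\}$, modulo $(L,L,K)$ (for $K=1$ this is the planar torus). $|\mathbb{S}_{L,K}|$ is the number of vertices and $o$ is the origin. For a finite undirected graph $G=(V,E)$, a dimer configuration is a spanning subgraph of $G$ in which every vertex has degree one (a perfect matching); $\mathcal{D}_G$ is the set of dimer configurations of $G$. For $A\subset V$, $G_A$ is the subgraph with vertex set $V\setminus A$ and all edges of $E$ not touching $A$, and $\mathcal{D}_G(A)$ is the set of dimer configurations of $G_A$. If $\mathcal{D}_G\neq\emptyset$, the monomer-monomer correlation is $$\mathcal{C}_G(x,y):=\frac{|\mathcal{D}_G(\{x,y\})|}{|\mathcal{D}_G|},\qquad x,y\in V,$$ and $\mathcal{C}_{L,K}:=\mathcal{C}_{\mathbb{S}_{L,K}}$. *)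

(* Defs.v *)
From mathcomp Require Import all_boot all_order all_algebra.
From mathcomp Require Import zify.
Set Implicit Arguments.
Unset Strict Implicit.
Unset Printing Implicit Defensive.
Import Order.TTheory GRing.Theory Num.Theory.
Local Open Scope ring_scope.

Section Dimers.
Variable T : finType.
Implicit Types (V A : {set T}) (E M : {set {set T}}).

Definition edge_set (e : rel T) : {set {set T}} :=
  [set [set p.1; p.2] | p in [set p : T * T | e p.1 p.2]].

(* A spanning subgraph of (V, E) is identified with its set of edges M. *)
Definition dimers V E : {set {set {set T}}} :=
  [set M : {set {set T}} |
     (M \subset E) && [forall x in V, #|[set f in M | x \in f]| == 1%N]].

Definition dimers_off (e : rel T) A : {set {set {set T}}} :=
  dimers (~: A) [set f in edge_set e | [disjoint f & A]].

(* If there is no dimer configuration, the division convention makes this 0. *)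
Definition monomer_corr (R : realFieldType) (e : rel T) (x y : T) : R :=
  #|dimers_off e [set x; y]|%:R / #|dimers [set: T] (edge_set e)|%:R.

End Dimers.

(* Membership in 2N \cup {1}, where N = {1, 2, ...}. *)
Definition is_side (n : nat) : bool := (n == 1%N) || ((0 < n)%N && ~~ odd n).

Definition vertex (L K : nat) : finType := ('I_L * 'I_L * 'I_K)%type.

(* The ordinal i stands for the i-th element, in increasing order, of the set
   of integers in (-n/2, n/2]; see coordP. *)
Definition coord (n : nat) (i : 'I_n) : int := i%:Z - (n.-1)./2%:Z.

Lemma coordP (n : nat) (z : int) : is_side n ->
  (exists i : 'I_n, coord i = z) <-> (- n%:Z < 2 * z) && (2 * z <= n%:Z).
Proof.
rewrite /is_side => hn; split=> [[i <-]|hz].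
  by rewrite /coord; have := ltn_ord i; lia.
have h : (`|(z + (n.-1)./2%:Z)%R| < n)%N by lia.
by exists (Ordinal h); rewrite /coord /=; lia.
Qed.

Definition pos (L K : nat) (v : vertex L K) (j : 'I_3) : int :=
  [:: coord v.1.1; coord v.1.2; coord v.2]`_j.

Definition period (L K : nat) (j : 'I_3) : nat := nth 1%N [:: L; L; K] j.

Definition slab_torus (L K : nat) : rel (vertex L K) := fun u v =>
  (u != v) &&
  [exists i : 'I_3, exists s : bool, forall j : 'I_3,
     (pos u j == pos v j + (-1) ^+ s * (i == j)%:Z %[mod period L K j])%Z].

Lemma mid_lt (n : nat) : is_side n -> ((n.-1)./2 < n)%N.
Proof. by rewrite /is_side; lia. Qed.

Definition origin (L K : nat) (hL : is_side L) (hK : is_side K) : vertex L K :=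
  (Ordinal (mid_lt hL), Ordinal (mid_lt hL), Ordinal (mid_lt hK)).

Lemma pos_origin (L K : nat) (hL : is_side L) (hK : is_side K) (j : 'I_3) :
  pos (origin hL hK) j = 0.
Proof. by case: j => -[|[|[|]]] //= ?; rewrite /pos /coord /= subrr. Qed.

(* Main.v *)
Require Import Defs.
From mathcomp Require Import all_boot all_order all_algebra.
From mathcomp Require Import zify ring lra.
Set Implicit Arguments.
Unset Strict Implicit.
Unset Printing Implicit Defensive.
Import Order.TTheory GRing.Theory Num.Theory.
Local Open Scope ring_scope.

(** The slab is a cycle of [L = 2 N] slices, each a copy of the graph C_L x C_K.
    Recording, between consecutive slices, which vertices of a slice are matched
    across gives a transfer matrix [T], indexed by the sets of vertices of a slice.
    It is symmetric, the number of matchings [D] is the trace of [T ^+ L], and a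
    matching count with prescribed edges or monomers is the trace of a word in [T] and in the
    operators [create X] that remove [X] from a slice ([nmatch_chain]).

    Averaging. The sum over all [y, y'] of the counts with monomers at [y] and [y'] in
    two slices at distance [n] is [\tr (A * T ^+ (n - 1) * A * T ^+ (L - n - 1))] with [A]
    symmetric. The Cauchy-Schwarz inequality makes it midpoint convex in [n], so it is
    largest at [n = 1] ([pair_corr_max]).  By translation invariance it remains to
    bound the correlation of two monomers in adjacent slices, averaged over one of
    them ([averaging]).

    Adjacent monomers. Let [S] be the random set of vertices of one slice matched to
    the next slice; its law is the diagonal of [G = T ^+ L], normalized.  The
    correlation of monomers at [y] and [y'] sums entries of [G] between sets that
    differ by exchanging [y] for [y'].  If [s] is a function with
    [`|s y' - s y| = 1] and q(S) is the sum of [s] over [S], then q separates the two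
    sets, and since [G] is positive semidefinite the correlation is at most
    lam * E q^2 + 1 / lam for every [lam > 0] ([tr_pair_moment]).

    Choice of [s]. Every vertex lies in exactly one edge of a matching, so a field
    with alternating signs is conserved along the slices.  Take [s] to be the sign
    times [profile], a logarithmic bump on blocks of two columns.  Extending the
    bump to a logarithmic cone in the two long directions and summing by parts, q
    becomes a sum, over blocks, of the increments of the cone times the
    difference of the occupation numbers of two parallel neighbouring edges
    ([flow_conservation]).  Such a staggered sum, with coefficients [a], has second
    moment at most 3 times the sum of the [a ^+ 2] ([staggered_variance]): the
    covariances of different slices add up to minus a form that is positive by
    reflection symmetry ([loop_pos]), and what remains is local.  The cone has
    energy at most 4 K / h, where h is the harmonic number of its radius, so
    E q^2 <= 24 K / h with h of order [ln L] ([moment_le]), and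
    [lam = Num.sqrt (ln L / K)] gives the theorem. *)

(** * Perfect matchings of induced subgraphs *)

Section Matchings.
Variables (V : finType) (e : rel V).
Hypotheses (e_sym : symmetric e) (e_irr : irreflexive e).
Implicit Types (W f : {set V}) (M : {set {set V}}) (x y : V).

(** Indexed by the set that is kept, the counts satisfy a recursion.  The lock
    keeps membership in [matchings W] from being unfolded by [inE]. *)
Definition matchings W : {set {set {set V}}} := locked (dimers_off e (~: W)).
Definition nmatch W : nat := #|matchings W|.

Lemma matchingsP W M :
  reflect ((forall f, f \in M -> f \in edge_set e /\ f \subset W) /\
           (forall x, x \in W -> #|[set f in M | x \in f]| = 1%N))
          (M \in matchings W).
Proof.
rewrite /matchings -lock /dimers_off /dimers !inE setCK.
apply: (iffP andP) => [[/subsetP sM /forall_inP hM]|[h1 h2]]; split.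
- by move=> f /sM; rewrite inE => /andP[-> ]; rewrite disjoints_subset setCK.
- by move=> x /hM/eqP.
- apply/subsetP => f /h1[fe fW]; rewrite inE fe disjoints_subset setCK //.
- by apply/forall_inP => x /h2/eqP.
Qed.

Lemma edge_setP f : reflect (exists x y, e x y /\ f = [set x; y]) (f \in edge_set e).
Proof.
apply: (iffP imsetP) => [[[x y]]|[x [y [exy ->]]]].
  by rewrite inE /= => exy ->; exists x, y.
by exists (x, y); rewrite ?inE.
Qed.

Lemma mem_edge x y : e x y -> [set x; y] \in edge_set e.
Proof. by move=> exy; apply/edge_setP; exists x, y. Qed.

Lemma edge_at f x : f \in edge_set e -> x \in f -> exists2 y, e x y & f = [set x; y].
Proof.
move=> /edge_setP[a [b [eab ->]]]; rewrite !inE => /orP[/eqP->|/eqP->].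
  by exists b.
by exists a; rewrite 1?e_sym // setUC.
Qed.

Lemma matching_uniq W M f f' x : M \in matchings W -> f \in M -> f' \in M ->
  x \in f -> x \in f' -> f = f'.
Proof.
move=> /matchingsP[h1 h2] fM f'M xf xf'.
have xW : x \in W by have [_ /subsetP] := h1 f fM; apply.
have /eqP/cards1P[f0 E] := h2 x xW.
have : f \in [set f in M | x \in f] by rewrite inE fM.
have : f' \in [set f in M | x \in f] by rewrite inE f'M.
by rewrite E => /set1P-> /set1P->.
Qed.

Lemma matching_cover W M x : M \in matchings W -> x \in W -> exists2 f, f \in M & x \in f.
Proof.
move=> /matchingsP[h1 h2] /h2/eqP/cards1P[f0 E].
have : f0 \in [set f in M | x \in f] by rewrite E set11.
by rewrite inE => /andP[]; exists f0.
Qed.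

Lemma matching_del W M f : f \in edge_set e -> M \in matchings W -> f \in M ->
  M :\ f \in matchings (W :\: f).
Proof.
move=> fe hM fM; have [h1 h2] := matchingsP _ _ hM.
apply/matchingsP; split=> [f'|x].
  rewrite !inE => /andP[nf f'M]; have [-> f'W] := h1 _ f'M; split=> //.
  apply/subsetP => x xf'; rewrite inE (subsetP f'W) // andbT.
  by apply: contra nf => xf; apply/eqP; apply: (matching_uniq hM f'M fM xf' xf).
rewrite inE => /andP[xf xW]; rewrite -(h2 x xW); apply: eq_card => f'.
rewrite !inE; case: (altP (f' =P f)) => [->|] //=.
by rewrite (negbTE xf) andbF.
Qed.

Lemma matching_add W M f : f \in edge_set e -> f \subset W -> M \in matchings (W :\: f) ->
  f |: M \in matchings W /\ f \notin M.
Proof.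
move=> fe fW hM; have [h1 h2] := matchingsP _ _ hM.
have nfM : f \notin M.
  apply/negP => /h1[_ /subsetP h].
  have /edge_setP[x [y [exy E]]] := fe.
  have xf : x \in f by rewrite E !inE eqxx.
  by have := h x xf; rewrite inE xf.
split=> //; apply/matchingsP; split=> [f'|x xW].
  rewrite !inE => /orP[/eqP->|/h1[-> hs]] //; split=> //.
  by apply: subset_trans hs (subsetDl _ _).
case xf: (x \in f).
  apply/eqP/cards1P; exists f; apply/setP => f'; rewrite !inE.
  case: (altP (f' =P f)) => [->|] //= _; apply/negbTE/negP => /andP[/h1[_ /subsetP h] /h].
  by rewrite inE xf.
have xWf : x \in W :\: f by rewrite inE xf.
rewrite -(h2 _ xWf); apply: eq_card => f'; rewrite !inE.
by case: (altP (f' =P f)) => [->|] //=; rewrite xf andbF.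
Qed.

(** Deleting [f] is a bijection onto the matchings of what [f] does not cover. *)
Lemma card_matchings_edge (P : pred {set {set V}}) W f : f \in edge_set e -> f \subset W ->
  #|[set M in matchings W | (f \in M) && P (M :\ f)]| = #|[set M in matchings (W :\: f) | P M]|.
Proof.
move=> fe fW.
rewrite -(card_in_imset (f := fun M => f |: M) (D := [set M in matchings (W :\: f) | P M])).
  apply: eq_card => M; rewrite inE; apply/andP/imsetP => [[hM /andP[fM PM]]|[M']].
    exists (M :\ f); last by rewrite setD1K.
    by rewrite inE PM andbT; apply: matching_del.
  rewrite inE => /andP[hM' PM'] ->; have [h1 h2] := matching_add fe fW hM'.
  by rewrite h1 setU11 /= setU1K.
move=> M M'; rewrite !inE => /andP[hM _] /andP[hM' _] E.
have [_ nM] := matching_add fe fW hM; have [_ nM'] := matching_add fe fW hM'.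
by rewrite -(setU1K nM) E setU1K.
Qed.

Lemma card_matchings1 W f : f \in edge_set e -> f \subset W ->
  #|[set M in matchings W | f \in M]| = nmatch (W :\: f).
Proof.
move=> fe fW; have := card_matchings_edge predT fe fW.
rewrite /nmatch => E; transitivity #|[set M in matchings W | (f \in M) && predT (M :\ f)]|.
  by apply: eq_card => M; rewrite !inE andbT.
by rewrite E; apply: eq_card => M; rewrite !inE andbT.
Qed.

Lemma card_matchings2 W f f' : f \in edge_set e -> f' \in edge_set e -> f \subset W -> f' \subset W ->
  [disjoint f & f'] ->
  #|[set M in matchings W | (f \in M) && (f' \in M)]| = nmatch (W :\: (f :|: f')).
Proof.
move=> fe f'e fW f'W dff'.
have nff' : f' != f.
  have /edge_setP[x [y [exy E]]] := fe; apply: contraTneq dff' => ->.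
  rewrite -setI_eq0; apply/set0Pn; exists x; by rewrite E !inE eqxx.
have := card_matchings_edge (fun M => f' \in M) fe fW.
rewrite card_matchings1 //; last by rewrite subsetD f'W disjoint_sym.
rewrite setDDl => <-; apply: eq_card => M; rewrite !inE nff' //.
Qed.

Lemma card_matchings2_meet W f f' : f != f' -> ~~ [disjoint f & f'] ->
  #|[set M in matchings W | (f \in M) && (f' \in M)]| = 0%N.
Proof.
move=> nff'; rewrite -setI_eq0 => /set0Pn[x]; rewrite inE => /andP[xf xf'].
apply: eq_card0 => M; rewrite !inE; apply/negP => /andP[hM /andP[fM f'M]].
by have := matching_uniq hM fM f'M xf xf'; apply/eqP.
Qed.

Lemma matching_sum1 W M x : M \in matchings W -> x \in W ->
  (\sum_(y | e x y) ([set x; y] \in M) = 1)%N.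
Proof.
move=> hM xW; have [f fM xf] := matching_cover hM xW.
have [h1 _] := matchingsP _ _ hM; have [fe fW] := h1 _ fM.
have [y exy E] := edge_at fe xf.
rewrite (bigD1 y) //= -E fM big1 ?addn0 // => z /andP[exz nzy].
case: (boolP (_ \in M)) => // zM.
have : f = [set x; z] by apply: (matching_uniq hM fM zM xf); rewrite !inE eqxx.
move=> /setP/(_ z); rewrite E !inE eqxx orbT (negbTE nzy) orbF => /eqP zx.
by move: exz; rewrite zx e_irr.
Qed.

Lemma nmatch_rec W x : x \in W ->
  nmatch W = (\sum_(y | e x y && (y \in W)) nmatch (W :\: [set x; y]))%N.
Proof.
move=> xW; rewrite /nmatch -sum1_card.
rewrite (eq_bigr (fun M => \sum_(y | e x y) ([set x; y] \in M))%N); last first.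
  by move=> M hM; rewrite (matching_sum1 hM xW).
rewrite exchange_big /= big_mkcondr /=; apply: eq_bigr => y exy.
case: ifP => yW.
  rewrite -/(nmatch _) -card_matchings1 ?mem_edge //; last first.
    by apply/subsetP => z; rewrite !inE => /orP[]/eqP->.
  rewrite -sum1_card big_mkcond [RHS]big_mkcond; apply: eq_bigr => M _.
  by rewrite inE; case: (_ \in matchings _); case: (_ \in M).
apply: big1 => M hM; case: (boolP (_ \in M)) => // fM.
have [h1 _] := matchingsP _ _ hM; have [_ /subsetP fW] := h1 _ fM.
by move: yW; rewrite fW // !inE eqxx orbT.
Qed.

Lemma nmatch0 : nmatch set0 = 1%N.
Proof.
rewrite /nmatch; apply/eqP/cards1P; exists set0; apply/setP => M; rewrite inE.
apply/matchingsP/eqP => [[h1 _]|->]; last by split=> x; rewrite inE.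
apply/setP => f; rewrite inE; apply/negP => /h1[/edge_setP[x [y [_ ->]]] /subsetP].
by move/(_ x); rewrite !inE eqxx => /(_ isT).
Qed.

Definition nmatch2 f f' : nat := #|[set M in matchings setT | (f \in M) && (f' \in M)]|.

Lemma nmatch2E f f' : f \in edge_set e -> f' \in edge_set e ->
  nmatch2 f f' = if f == f' then nmatch (~: f) else
            if [disjoint f & f'] then nmatch (~: (f :|: f')) else 0%N.
Proof.
move=> fe f'e; rewrite /nmatch2; case: eqP => [<-|/eqP nff'].
  rewrite -setTD -card_matchings1 ?subsetT //; apply: eq_card => M; by rewrite !inE andbb.
case: ifP => d; last by rewrite card_matchings2_meet ?d.
by rewrite card_matchings2 ?subsetT ?setTD.
Qed.

Lemma nmatch2_le f f' : (nmatch2 f f' <= nmatch setT)%N.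
Proof. by apply: subset_leq_card; apply/subsetP => M; rewrite inE => /andP[]. Qed.

(** The conservation law behind the whole argument: a matching gives each vertex
    exactly one neighbour, so it sees the total weight of any function. *)
Lemma matching_weight (R : pzRingType) (psi : V -> R) M : M \in matchings setT ->
  \sum_x \sum_(y | e x y) psi x * ([set x; y] \in M)%:R = \sum_x psi x.
Proof.
move=> hM; apply: eq_bigr => x _; rewrite -mulr_sumr -natr_sum.
by rewrite (matching_sum1 hM) ?inE // mulr1.
Qed.

End Matchings.

(** The recursion [nmatch_rec] determines the counts, and it is invariant. *)
Lemma nmatch_iso (V V' : finType) (e : rel V) (e' : rel V') (h : V -> V') :
  symmetric e -> irreflexive e -> symmetric e' -> irreflexive e' ->
  bijective h -> (forall x y, e' (h x) (h y) = e x y) ->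
  forall W : {set V}, nmatch e' (h @: W) = nmatch e W.
Proof.
move=> s i s' i' bh hE W.
have ih := bij_inj bh.
have [n] := ubnP #|W|; elim: n W => // n IH W leW.
have [->|[x xW]] := set_0Vmem W; first by rewrite imset0 !nmatch0.
rewrite (nmatch_rec s i xW) (nmatch_rec s' i' (x := h x)) ?imset_f //.
rewrite (reindex h) /=; last by apply: onW_bij.
apply: eq_big => [y|y /andP[exy yW]]; first by rewrite hE mem_imset.
rewrite -IH.
  congr nmatch; apply/setP => z; have [k hk kh] := bh; rewrite -(kh z) !inE !mem_imset // !inE.
  by rewrite !(inj_eq ih).
rewrite -ltnS; apply: leq_trans leW; rewrite ltnS.
by apply: proper_card; apply/properP; split; [apply: subsetDl|exists x; rewrite ?inE ?eqxx].
Qed.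

Lemma nmatch2_iso (V V' : finType) (e : rel V) (e' : rel V') (h : V -> V') :
  symmetric e -> irreflexive e -> symmetric e' -> irreflexive e' ->
  bijective h -> (forall x y, e' (h x) (h y) = e x y) ->
  forall f f', f \in edge_set e -> f' \in edge_set e -> nmatch2 e' (h @: f) (h @: f') = nmatch2 e f f'.
Proof.
move=> s i s' i' bh hE f f' fe f'e.
have ih := bij_inj bh.
have he g : g \in edge_set e -> h @: g \in edge_set e'.
  move=> /edge_setP[x [y [exy ->]]]; apply/edge_setP; exists (h x), (h y).
  by rewrite hE exy imsetU1 imset_set1.
rewrite !nmatch2E ?he // (inj_eq (imset_inj ih)).
have hC (A : {set V}) : ~: (h @: A) = h @: (~: A).
  apply/setP => y; have [k hk kh] := bh; rewrite -(kh y) inE !mem_imset // inE //.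
rewrite -imsetU !hC !(nmatch_iso s i s' i' bh hE).
suff -> : [disjoint h @: f & h @: f'] = [disjoint f & f'] by [].
by rewrite -!setI_eq0 -imsetI ?imset_eq0 //; apply: in2W.
Qed.

(** * Gram kernels and Polya's criterion on a cycle *)

Lemma tr_C (R : realFieldType) n (A B : 'M[R]_n) : \tr (A * B) = \tr (B * A).
Proof. exact: mxtrace_mulC. Qed.

Lemma scaleMl (R : realFieldType) n a (A B : 'M[R]_n) : (a *: A) * B = a *: (A * B).
Proof. by apply/esym; apply: scalemxAl. Qed.

Lemma scaleMr (R : realFieldType) n a (A B : 'M[R]_n) : A * (a *: B) = a *: (A * B).
Proof. by apply/esym; apply: scalemxAr. Qed.

Section Frob.
Variables (R : realFieldType) (n : nat).
Implicit Types A B X Y : 'M[R]_n.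

Lemma trM A B : (A * B)^T = B^T * A^T. Proof. exact: trmx_mul. Qed.

Definition frob X Y : R := \tr (X^T * Y).

Lemma frobC X Y : frob X Y = frob Y X.
Proof. by rewrite /frob -mxtrace_tr trM trmxK. Qed.

Lemma frobE X Y : frob X Y = \sum_i \sum_j X i j * Y i j.
Proof.
rewrite /frob /mxtrace exchange_big; apply: eq_bigr => j _; rewrite mxE.
by apply: eq_bigr => i _; rewrite mxE.
Qed.

Lemma frob_ge0 X : 0 <= frob X X.
Proof. by rewrite frobE; do 2!apply: sumr_ge0 => ? _; rewrite -expr2 sqr_ge0. Qed.

Lemma frob_suml (I : Type) (r : seq I) (F : I -> 'M_n) Y :
  frob (\sum_(i <- r) F i) Y = \sum_(i <- r) frob (F i) Y.
Proof. by rewrite /frob raddf_sum mulr_suml raddf_sum. Qed.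

Lemma frob_sumr (I : Type) (r : seq I) (F : I -> 'M_n) X :
  frob X (\sum_(i <- r) F i) = \sum_(i <- r) frob X (F i).
Proof. by rewrite frobC frob_suml; apply: eq_bigr => i _; rewrite frobC. Qed.

Lemma frobBl X Y Z : frob (X - Y) Z = frob X Z - frob Y Z.
Proof. by rewrite /frob raddfB mulrBl raddfB. Qed.

Lemma frobBr X Y Z : frob Z (X - Y) = frob Z X - frob Z Y.
Proof. by rewrite frobC frobBl ![frob _ Z]frobC. Qed.

Lemma frobZl a X Y : frob (a *: X) Y = a * frob X Y.
Proof.
rewrite !frobE mulr_sumr; apply: eq_bigr => i _; rewrite mulr_sumr; apply: eq_bigr => j _.
by rewrite mxE mulrA.
Qed.

Lemma frobZr a X Y : frob Y (a *: X) = a * frob Y X.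
Proof. by rewrite frobC frobZl frobC. Qed.

Lemma count_window M a b : (\sum_(s < M) (a <= s < b) = minn b M - a)%N.
Proof.
elim: M => [|M IH]; first by rewrite big_ord0; lia.
by rewrite big_ord_recr /= IH; lia.
Qed.

(** The tent kernel (k - |i - j|)_+ counts the windows of length [k] that contain both
    [i] and [j], hence it is a sum of squares. *)
Lemma window_kernel_ge0 (v : nat -> 'M[R]_n) m k :
  0 <= \sum_(i < m) \sum_(j < m) (k - ((i - j) + (j - i)))%N%:R * frob (v i) (v j).
Proof.
pose w (s i : nat) : R := (i <= s < i + k)%:R.
have E (i j : 'I_m) : (k - ((i - j) + (j - i)))%N%:R = \sum_(s < m + k) w s i * w s j.
  rewrite (eq_bigr (fun s : 'I__ => ((maxn i j <= s < minn i j + k)%N)%:R)); last first.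
    by move=> s _; rewrite /w -natrM mulnb; congr (_ %:R); lia.
  rewrite -natr_sum count_window; congr (_ %:R).
  by have := ltn_ord i; have := ltn_ord j; lia.
rewrite (eq_bigr (fun i : 'I_m => \sum_(s < m + k) \sum_(j < m) frob (w s i *: v i) (w s j *: v j))).
  rewrite exchange_big; apply: sumr_ge0 => s _.
  rewrite (eq_bigr (fun i : 'I_m => frob (w s i *: v i) (\sum_(j < m) w s j *: v j))).
    by rewrite -frob_suml frob_ge0.
  by move=> i _; rewrite frob_sumr.
move=> i _; rewrite exchange_big; apply: eq_bigr => j _; rewrite E mulr_suml.
by apply: eq_bigr => s _; rewrite frobZl frobZr mulrA.
Qed.

Lemma gram_ge0 (v : nat -> 'M[R]_n) m :
  0 <= \sum_(i < m) \sum_(j < m) frob (v i) (v j).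
Proof.
rewrite (eq_bigr (fun i : 'I_m => frob (v i) (\sum_(j < m) v j))).
  by rewrite -frob_suml frob_ge0.
by move=> i _; rewrite frob_sumr.
Qed.

End Frob.

Section Abel.
Variable R : realFieldType.
Implicit Type f : nat -> R.
Definition diff2 f k := f k.+2 + f k - 2 * f k.+1.

(** Discrete Taylor formula: up to [n], a function is its affine part at [n] plus
    tents weighted by the second differences. *)
Lemma second_order_abel f n d : (d <= n)%N ->
  f d = f n + (n - d)%N%:R * (f n - f n.+1) + \sum_(k < n) (k.+1 - d)%N%:R * diff2 f k.
Proof.
elim: n d => [|n IH] d.
  by rewrite leqn0 => /eqP->; rewrite big_ord0 subnn mul0r !addr0.
rewrite leq_eqVlt => /orP[/eqP->|dn].
  rewrite subnn mul0r addr0 big1 ?addr0 // => k _.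
  by rewrite (_ : _ - _ = 0)%N ?mul0r //; have := ltn_ord k; lia.
rewrite big_ord_recr /= (IH d) // /diff2 subSn // -natr1; ring.
Qed.

Lemma sum_diff2 f a c : \sum_(k < c) diff2 f (a + k) = f (a + c).+1 - f (a + c)%N - f a.+1 + f a.
Proof.
elim: c => [|c IH]; first by rewrite big_ord0 addn0; ring.
by rewrite big_ord_recr /= IH /diff2 addnS; ring.
Qed.
End Abel.

Section Polya.
Variables (R : realFieldType) (n : nat) (T : 'M[R]_n) (N : nat).
Hypothesis T_sym : T^T = T.

Lemma exp_sym k : (T ^+ k)^T = T ^+ k.
Proof. by elim: k => [|k IH]; rewrite ?expr0 ?trmx1 // exprS trM IH T_sym -exprSr exprS. Qed.

(** The correlation of [B] and [B'] placed on a cycle, at distances [d] and [e] along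
    its two arcs. *)
Definition loop (d e : nat) (B B' : 'M[R]_n) : R := \tr (B^T * T ^+ d * B' * T ^+ e).

Lemma frob_loop a b c e B B' :
  frob (T ^+ a * B * T ^+ b) (T ^+ c * B' * T ^+ e) = loop (a + c) (b + e) B B'.
Proof.
rewrite /frob /loop !trM !exp_sym [(b + e)%N]addnC !exprD.
by rewrite -!mulrA tr_C !mulrA.
Qed.

Lemma loop_sym d e B B' : loop d e B B' = loop d e B' B.
Proof.
rewrite /loop -mxtrace_tr !trM !exp_sym trmxK tr_C !mulrA.
by rewrite -mulrA tr_C !mulrA.
Qed.

(** Transposition reverses the cycle. *)
Lemma loop_anti d e B B' : B^T = - B -> B'^T = - B' -> loop d e B B' = loop e d B B'.
Proof.
move=> hB hB'; rewrite loop_sym /loop hB hB' !mulNr !raddfN /=; congr (- _).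
by rewrite -mulrA tr_C !mulrA.
Qed.

(** Polya's criterion: a nonnegative, nonincreasing, convex function of |i - j| is a
    positive combination of tents, so it is a positive kernel.  Here convexity is that of a kernel:
    the second difference of the correlation in the distance is the Gram kernel of the
    [Z k i].  On a cycle the slope at the end of the range has the right sign because
    antisymmetry makes the correlation symmetric about [N]. *)
Lemma loop_pos (B : nat -> 'M[R]_n) m : (forall i, (B i)^T = - B i) -> (2 * m <= N)%N ->
  0 <= \sum_(i < m) \sum_(j < m)
     loop (2 * ((i - j) + (j - i))) (2 * (N - ((i - j) + (j - i)))) (B i) (B j).
Proof.
case: m => [|m] hB hm; first by rewrite big_ord0.
pose f (i j d : nat) := loop (2 * d) (2 * (N - d)) (B i) (B j).
pose Z (k i : nat) := T ^+ k.+2 * B i * T ^+ (N - k.+2) - T ^+ k * B i * T ^+ (N - k).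
have hZ k i j : (k.+2 <= N)%N -> diff2 (f i j) k = frob (Z k i) (Z k j).
  move=> hk; rewrite /Z frobBl !frobBr !frob_loop /diff2 /f.
  have -> : (k.+2 + k.+2 = 2 * k.+2)%N by lia.
  have -> : (N - k.+2 + (N - k.+2) = 2 * (N - k.+2))%N by lia.
  have -> : (k + k = 2 * k)%N by lia.
  have -> : (N - k + (N - k) = 2 * (N - k))%N by lia.
  have -> : (k + k.+2 = 2 * k.+1)%N by lia.
  have -> : (k.+2 + k = 2 * k.+1)%N by lia.
  have -> : (N - k.+2 + (N - k) = 2 * (N - k.+1))%N by lia.
  have -> : (N - k + (N - k.+2) = 2 * (N - k.+1))%N by lia.
  by ring.
have f_refl i j d : (d <= N)%N -> f i j (N - d)%N = f i j d.
  by move=> hd; rewrite /f subKn // loop_anti.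
(* The slope at [m] is half the sum of the second differences between [m] and its mirror image. *)
have hs i j : f i j m - f i j m.+1 = 2^-1 * \sum_(k < (N - m.*2.+2).+1) diff2 (f i j) (m + k).
  rewrite sum_diff2.
  have -> : ((m + (N - m.*2.+2).+1).+1 = N - m)%N by lia.
  have -> : (m + (N - m.*2.+2).+1 = N - m.+1)%N by lia.
  rewrite !f_refl; [|lia|lia].
  by field.
pose dd (i j : nat) := ((i - j) + (j - i))%N.
have E (i j : 'I_m.+1) : loop (2 * dd i j) (2 * (N - dd i j)) (B i) (B j) =
    frob (T ^+ m * B i * T ^+ (N - m)) (T ^+ m * B j * T ^+ (N - m)) +
    2^-1 * (\sum_(k < (N - m.*2.+2).+1) (m - dd i j)%N%:R * frob (Z (m + k) i)%N (Z (m + k) j)%N) +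
    \sum_(k < m) (k.+1 - dd i j)%N%:R * frob (Z k i) (Z k j).
  have hd : (dd i j <= m)%N by rewrite /dd; have := ltn_ord i; have := ltn_ord j; lia.
  rewrite -/(f i j (dd i j)) (second_order_abel (f i j) hd) hs; congr (_ + _ + _).
  - by rewrite frob_loop /f; congr loop; lia.
  - rewrite mulrCA; congr (_ * _); rewrite mulr_sumr; apply: eq_bigr => k _.
    by rewrite hZ //; have := ltn_ord k; lia.
  - by apply: eq_bigr => k _; rewrite hZ //; have := ltn_ord k; lia.
under eq_bigr => i _ do under eq_bigr => j _ do rewrite E.
under eq_bigr => i _ do rewrite !big_split /=.
rewrite !big_split /=; apply: addr_ge0; first apply: addr_ge0.
- exact: (gram_ge0 (fun i => T ^+ m * B i * T ^+ (N - m))).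
- under eq_bigr => i _ do rewrite -mulr_sumr exchange_big /=.
  rewrite -mulr_sumr exchange_big /=; apply: mulr_ge0; first by rewrite invr_ge0.
  by apply: sumr_ge0 => k _; apply: (window_kernel_ge0 (Z (m + k)%N)).
- under eq_bigr => i _ do rewrite exchange_big /=.
  by rewrite exchange_big /=; apply: sumr_ge0 => k _; apply: (window_kernel_ge0 (Z k)).
Qed.

End Polya.

(** * Matrices indexed by sets of vertices; the transfer matrix *)

Section SetMatrix.
Variables (R : realFieldType) (Y : finType).
Implicit Types (S X W : {set Y}).
Notation mat := 'M[R]_#|{set Y}|.
Implicit Types (A B : mat).

Definition setmx (f : {set Y} -> {set Y} -> R) : mat :=
  \matrix_(i, j) f (enum_val i) (enum_val j).
Definition entry A S S' : R := A (enum_rank S) (enum_rank S').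

Lemma entry_setmx f S S' : entry (setmx f) S S' = f S S'.
Proof. by rewrite /entry mxE !enum_rankK. Qed.

Lemma entryP A B : (forall S S', entry A S S' = entry B S S') -> A = B.
Proof.
move=> h; apply/matrixP => i j; have := h (enum_val i) (enum_val j).
by rewrite /entry !enum_valK.
Qed.

Lemma entryM A B S S' : entry (A * B) S S' = \sum_U entry A S U * entry B U S'.
Proof.
rewrite /entry mxE (reindex (@enum_rank {set Y})) //=.
by apply: onW_bij; apply: enum_rank_bij.
Qed.

Lemma entry_trace A : \tr A = \sum_S entry A S S.
Proof.
rewrite /mxtrace (reindex (@enum_rank {set Y})) //=.
by apply: onW_bij; apply: enum_rank_bij.
Qed.

Lemma entry_tr A S S' : entry A^T S S' = entry A S' S.
Proof. by rewrite /entry mxE. Qed.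

Lemma entryD A B S S' : entry (A + B) S S' = entry A S S' + entry B S S'.
Proof. by rewrite /entry mxE. Qed.

Lemma entry0 S S' : entry 0 S S' = 0.
Proof. by rewrite /entry mxE. Qed.

Lemma entry_sum (I : Type) (r : seq I) (P : pred I) (F : I -> mat) S S' :
  entry (\sum_(i <- r | P i) F i) S S' = \sum_(i <- r | P i) entry (F i) S S'.
Proof. by rewrite /entry summxE. Qed.

(** Creation operator; its transpose annihilates [X]. *)
Definition create X : mat := setmx (fun S S' => ([disjoint S & X] && (S' == S :|: X))%:R).

Lemma create_mul X A S S' : entry (create X * A) S S' = if [disjoint S & X] then entry A (S :|: X) S' else 0.
Proof.
rewrite entryM; case: ifP => d.
  rewrite (bigD1 (S :|: X)) //= entry_setmx d eqxx mul1r big1 ?addr0 // => U nU.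
  by rewrite entry_setmx d (negbTE nU) mul0r.
by apply: big1 => U _; rewrite entry_setmx d mul0r.
Qed.

Lemma set_split (X S U : {set Y}) : ([disjoint U & X] && (S == U :|: X)) = ((X \subset S) && (U == S :\: X)).
Proof.
apply/andP/andP => [[d /eqP->]|[d /eqP->]].
  rewrite subsetUr setDUl setDv setU0; split=> //; rewrite eq_sym; apply/eqP.
  by apply/setDidPl.
by rewrite disjoint_sym disjoints_subset setDE setCI setCK subsetUr setUC setUIr setUCr setIT; move/setUidPr: d => ->.
Qed.

Lemma createT_mul X A S S' : entry ((create X)^T * A) S S' = if X \subset S then entry A (S :\: X) S' else 0.
Proof.
rewrite entryM; case: ifP => d.
  rewrite (bigD1 (S :\: X)) //= entry_tr entry_setmx set_split d eqxx mul1r big1 ?addr0 // => U nU.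
  by rewrite entry_tr entry_setmx set_split d (negbTE nU) mul0r.
by apply: big1 => U _; rewrite entry_tr entry_setmx set_split d mul0r.
Qed.

Lemma mul_create X A S S' : entry (A * create X) S S' = if X \subset S' then entry A S (S' :\: X) else 0.
Proof. by rewrite -entry_tr trM createT_mul !entry_tr. Qed.

(** Creating one set commutes with annihilating a disjoint one: the only defect of
    commutation of the edge operators below is on a single edge. *)
Lemma create_comm X X' : [disjoint X & X'] -> create X * (create X')^T = (create X')^T * create X.
Proof.
move=> d; apply: entryP => S S'; rewrite create_mul createT_mul entry_tr !entry_setmx.
have -> : [disjoint S :\: X' & X] = [disjoint S & X].
  rewrite -!setI_eq0 setIDAC; congr (_ == _); apply/setDidPl.
  exact: disjointWl (subsetIr _ _) d.
rewrite set_split; have -> : (X' \subset S :|: X) = (X' \subset S).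
  have /setDidPl E : [disjoint X' & X] by rewrite disjoint_sym.
  by rewrite setUC -subDset E.
rewrite setDUl (setDidPl d) andbC.
by case: [disjoint S & X]; rewrite ?andbT ?andbF; case: (X' \subset S); rewrite ?andbT ?andbF.
Qed.

Lemma create_create X X' : [disjoint X & X'] -> create X * create X' = create (X :|: X').
Proof.
move=> d; apply: entryP => S S'; rewrite create_mul !entry_setmx.
rewrite -[in RHS]setI_eq0 setIUr setU_eq0 !setI_eq0 setUA.
case: ifP => //= dS; congr (_ %:R); congr (nat_of_bool (_ && _)).
by rewrite -setI_eq0 setIUl setU_eq0 !setI_eq0 d andbT.
Qed.

Lemma create_create0 X X' : ~~ [disjoint X & X'] -> create X * create X' = 0.
Proof.
move=> d; apply: entryP => S S'; rewrite create_mul !entry_setmx entry0.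
case: ifP => //= dS.
rewrite -setI_eq0 setIUl setU_eq0 !setI_eq0 (negbTE d) andbF //.
Qed.

Lemma create_createT X : create X * (create X)^T = setmx (fun S S' => ([disjoint S & X] && (S == S'))%:R).
Proof.
apply: entryP => S S'; rewrite create_mul entry_tr !entry_setmx set_split.
case: ifP => // d; rewrite subsetUr setDUl setDv setU0.
by rewrite (setDidPl d) eq_sym.
Qed.

Lemma createT_create X : (create X)^T * create X = setmx (fun S S' => ((X \subset S) && (S == S'))%:R).
Proof.
apply: entryP => S S'; rewrite createT_mul !entry_setmx.
case: ifP => // d; rewrite disjoint_sym disjoints_subset setDE setCI setCK subsetUr.
by rewrite setUC setUIr setUCr setIT (setUidPr d) eq_sym.
Qed.

Variables (g : rel Y).
Hypotheses (g_sym : symmetric g) (g_irr : irreflexive g).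

(** The slice [W] with the vertices of [S] matched to the previous slice and those of
    [S'] to the next one. *)
Definition transfer W : mat := setmx (fun S S' =>
  ([&& S \subset W, S' \subset W & [disjoint S & S']] * nmatch g (W :\: S :\: S'))%N%:R).

Lemma transfer_sym W : (transfer W)^T = transfer W.
Proof.
apply: entryP => S S'; rewrite entry_tr !entry_setmx disjoint_sym setDDl setUC -setDDl.
by rewrite andbCA.
Qed.

(** A vertex claimed by the previous slice is as good as removed. *)
Lemma create_transfer X W : X \subset W -> create X * transfer W = transfer (W :\: X).
Proof.
move=> sX; apply: entryP => S S'; rewrite create_mul !entry_setmx !subsetD.
rewrite !setDDl !setUA !subUset sX andbT [X :|: S]setUC.
have -> : [disjoint S :|: X & S'] = [disjoint S & S'] && [disjoint S' & X].
  by rewrite -setI_eq0 setIUl setU_eq0 !setI_eq0 [in X in _ && X]disjoint_sym.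
case: (boolP [disjoint S & X]) => //=; last by rewrite andbF mul0n.
by rewrite andbT; case: [disjoint S' & X]; rewrite ?andbT ?andbF.
Qed.

Lemma create_transfer0 X W : ~~ (X \subset W) -> create X * transfer W = 0.
Proof.
move=> sX; apply: entryP => S S'; rewrite create_mul !entry_setmx entry0.
by case: ifP => // _; rewrite subUset (negbTE sX) andbF mul0n.
Qed.

Lemma transfer_createT X W : X \subset W -> transfer W * (create X)^T = transfer (W :\: X).
Proof. by move=> sX; rewrite -[LHS]trmxK trM trmxK transfer_sym create_transfer // transfer_sym. Qed.

Lemma transfer_createT0 X W : ~~ (X \subset W) -> transfer W * (create X)^T = 0.
Proof. by move=> sX; rewrite -[LHS]trmxK trM trmxK transfer_sym create_transfer0 // trmx0. Qed.

Lemma entry_transfer_sym W S S' : entry (transfer W) S S' = entry (transfer W) S' S.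
Proof. by rewrite -entry_tr transfer_sym. Qed.

Lemma entry_transfer0 W S S' y : y \in S -> y \notin W -> entry (transfer W) S S' = 0.
Proof.
by move=> yS yW; rewrite entry_setmx; case: (boolP (S \subset W)) => // /subsetP/(_ y yS); rewrite (negbTE yW).
Qed.

Lemma entry_transfer_row W S S' y : y \in W -> y \in S ->
  entry (transfer (W :\ y)) (S :\ y) S' = entry (transfer W) S S'.
Proof.
move=> yW yS; rewrite !entry_setmx !subsetD1 !inE eqxx andbT subDset.
rewrite (setUidPr (_ : [set y] \subset W)) ?sub1set //.
have -> : [disjoint S & S'] = (y \notin S') && [disjoint S :\ y & S'].
  by rewrite -{1}(setD1K yS) -setI_eq0 setIUl setU_eq0 !setI_eq0 disjoints1.
rewrite !setDDl setUA setD1K //.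
by case: (y \in S'); rewrite ?andbF ?andbT.
Qed.

(** The partner of [y] lies in the slice, in the previous one, or in the next one. *)
Lemma transfer_rec W y : y \in W ->
  transfer W = \sum_(y' | g y y' && (y' \in W)) transfer (W :\: [set y; y'])
         + (create [set y])^T * transfer (W :\ y) + transfer (W :\ y) * create [set y].
Proof.
move=> yW; apply: entryP => S S'.
rewrite !entryD entry_sum createT_mul mul_create !sub1set.
have nyW : y \notin W :\ y by rewrite !inE eqxx.
have sum0 (U U' : {set Y}) : y \in U ->
    \sum_(y' | g y y' && (y' \in W)) entry (transfer (W :\: [set y; y'])) U U' = 0.
  by move=> yU; apply: big1 => y' _; apply: (entry_transfer0 _ yU); rewrite !inE eqxx.
case: (boolP (y \in S)) => yS.
  rewrite sum0 // add0r entry_transfer_row //; case: (boolP (y \in S')) => yS'.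
    by rewrite [X in _ + X](entry_transfer0 _ yS nyW) addr0.
  by rewrite addr0.
case: (boolP (y \in S')) => yS'.
  rewrite (eq_bigr _ (fun y' _ => entry_transfer_sym _ S S')) sum0 // !add0r.
  by rewrite entry_transfer_sym [RHS]entry_transfer_sym entry_transfer_row.
rewrite !addr0 entry_setmx.
case: (boolP [&& _, _ & _]) => [/and3P[SW S'W d]|h].
  rewrite mul1n (nmatch_rec g_sym g_irr (x := y)) ?inE ?yS ?yS' //.
  rewrite natr_sum; rewrite big_mkcond [RHS]big_mkcond /=.
  apply: eq_bigr => y' _; rewrite !inE entry_setmx.
  case: (g y y') => //=; case: (y' \in W); rewrite ?andbF //= andbT.
  rewrite !subsetD SW S'W d /= andbT.
  have dj (U : {set Y}) : y \notin U -> [disjoint U & [set y; y']] = (y' \notin U).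
    by move=> yU; rewrite disjoint_sym -setI_eq0 setIUl setU_eq0 !setI_eq0 !disjoints1 yU.
  have -> : W :\: [set y; y'] :\: S :\: S' = W :\: S :\: S' :\: [set y; y'].
    by apply/setP => z; rewrite !inE; case: (z == y); case: (z == y'); rewrite ?andbF.
  rewrite !dj //.
  case: (y' \in S); case: (y' \in S') => /=; rewrite ?mul0n ?mul1n //.
apply/esym; rewrite mul0n; apply: big1 => y' _; rewrite entry_setmx.
case: (boolP [&& _, _ & _]) => [/and3P[SW S'W d]|_]; last by rewrite mul0n.
case/negP: h; rewrite d andbT; apply/andP; split.
  exact: subset_trans SW (subsetDl _ _).
exact: subset_trans S'W (subsetDl _ _).
Qed.

End SetMatrix.

(** * Matchings of a chain of slices as traces *)

(** The adjacency of a cycle of length [n]; a loop for [n = 1], where no edge is meant,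
    and one edge for [n = 2]. *)
Definition cyc_adj (n : nat) (a b : 'I_n) : bool := (a == ordS b) || (b == ordS a).

Lemma cyc_adj_sym n : symmetric (@cyc_adj n).
Proof. by move=> a b; rewrite /cyc_adj orbC. Qed.

Section Chain.
Variables (R : realFieldType) (Y : finType) (g : rel Y).
Hypotheses (g_sym : symmetric g) (g_irr : irreflexive g).
Variables (L : nat) (L3 : (2 < L)%N).
Notation mat := 'M[R]_#|{set Y}|.

Definition chain : rel ('I_L * Y) := fun x z =>
  ((x.1 == z.1) && g x.2 z.2) || (cyc_adj x.1 z.1 && (x.2 == z.2)).

Lemma L_gt0 : (0 < L)%N. Proof. by apply: leq_ltn_trans L3. Qed.

(** Indexing the cycle by all naturals lets products over it start anywhere. *)
Definition cyc (k : nat) : 'I_L := Ordinal (ltn_pmod k L_gt0).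

Lemma cyc_ord (t : 'I_L) : cyc t = t.
Proof. by apply: val_inj; rewrite /= modn_small. Qed.

Lemma cycDL k : cyc (k + L) = cyc k.
Proof. by apply: val_inj; rewrite /= modnDr. Qed.

Lemma cyc_neq k k' : (k < k' < k + L)%N -> cyc k' != cyc k.
Proof.
move=> /andP[h1 h2]; apply/negP => /eqP/(congr1 val) /= /eqP.
rewrite eqn_mod_dvd; last exact: ltnW.
by move/dvdn_leq; rewrite subn_gt0 => /(_ h1); lia.
Qed.

Lemma ordS_ord (t : 'I_L) : ordS t = cyc t.+1.
Proof. by apply: val_inj. Qed.

Lemma ord_pred_cyc (t : 'I_L) : ord_pred t = cyc (t + L.-1).
Proof. by apply: val_inj => /=; congr (_ %% _)%N; have := L_gt0; lia. Qed.

Lemma ordS_cyc k : ordS (cyc k) = cyc k.+1.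
Proof. by apply: val_inj => /=; rewrite -addn1 modnDml addn1. Qed.

Lemma cyc_nbrs_neq (t : 'I_L) : [/\ ordS t != t, ord_pred t != t & ord_pred t != ordS t].
Proof.
split.
- by rewrite ordS_ord -{2}(cyc_ord t) cyc_neq //; lia.
- by rewrite ord_pred_cyc -{2}(cyc_ord t) cyc_neq //; have := L_gt0; lia.
- by rewrite ordS_ord ord_pred_cyc cyc_neq //; have := L_gt0; lia.
Qed.

Lemma cyc_adjE (t u : 'I_L) : cyc_adj t u = (u == ordS t) || (u == ord_pred t).
Proof.
rewrite /cyc_adj orbC; congr (_ || _); apply/eqP/eqP => [->|->]; first by rewrite ordSK.
by rewrite ord_predK.
Qed.

Lemma chain_sym : symmetric chain.
Proof. by move=> x z; rewrite /chain eq_sym g_sym cyc_adj_sym [x.2 == _]eq_sym. Qed.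

Lemma chain_irr : irreflexive chain.
Proof.
move=> x; rewrite /chain g_irr andbF /= cyc_adjE; have [h1 h2 _] := cyc_nbrs_neq x.1.
by rewrite ![x.1 == _]eq_sym (negbTE h1) (negbTE h2).
Qed.

Definition cyc_trace (F : 'I_L -> mat) : R := \tr (\prod_(t < L) F t).

Lemma cyc_trace_rot F s : cyc_trace F = \tr (\prod_(s <= k < s + L) F (cyc k)).
Proof.
elim: s => [|s ->].
  by rewrite add0n big_mkord /cyc_trace; congr (\tr _); apply: eq_bigr => t _; rewrite cyc_ord.
have h : (s < s + L)%N by have := L_gt0; lia.
rewrite big_ltn // addSn big_nat_recr //= cycDL.
exact: tr_C.
Qed.

Definition far_prod F (t : 'I_L) : mat := \prod_(t.+2 <= k < t + L.-1) F (cyc k).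

(** By cyclicity the product can be started at the slice before [t]; the remaining
    factors do not see the slice [t] or its neighbours. *)
Lemma cyc_trace3 F t : cyc_trace F = \tr (F (ord_pred t) * F t * F (ordS t) * far_prod F t).
Proof.
rewrite (cyc_trace_rot F t) ordS_ord ord_pred_cyc /far_prod.
have -> : (t + L = (t + L.-1).+1)%N by have := L_gt0; lia.
rewrite big_nat_recr /=; last by lia.
rewrite big_ltn; last by have := L3; lia.
rewrite big_ltn; last by have := L3; lia.
by rewrite cyc_ord tr_C !mulrA.
Qed.

Lemma eq_far_prod F F' t : (forall u, u != ord_pred t -> u != t -> u != ordS t -> F u = F' u) ->
  far_prod F t = far_prod F' t.
Proof.
move=> h; apply: eq_big_nat => k /andP[k1 k2]; apply: h.
- by rewrite ord_pred_cyc eq_sym cyc_neq //; lia.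
- by rewrite -[X in _ != X]cyc_ord cyc_neq //; lia.
- by rewrite ordS_ord cyc_neq //; lia.
Qed.

Definition slice (W : {set 'I_L * Y}) (t : 'I_L) : {set Y} := [set y | (t, y) \in W].

Lemma slice_del W a b t : slice (W :\: [set a; b]) t =
  [set y in slice W t | ((t, y) != a) && ((t, y) != b)].
Proof. by apply/setP => y; rewrite !inE negb_or andbC. Qed.

Notation T_ := (@transfer R Y g).

Lemma transfer0_idem : T_ set0 * T_ set0 = T_ set0.
Proof.
apply: entryP => S S'; rewrite entryM (bigD1 set0) //= big1 ?addr0.
  rewrite !entry_setmx !sub0set !set0D !subset0 nmatch0 !muln1 -natrM mulnb.
  by do 2!case: eqP => [->|] //=; rewrite -?setI_eq0 ?setI0 ?eqxx ?andbF.
by move=> U nU; rewrite entry_setmx !subset0 (negbTE nU) andbF /= mul0n mul0r.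
Qed.

Lemma transfer0_tr : \tr (T_ set0) = 1.
Proof.
rewrite entry_trace (bigD1 set0) //= big1 ?addr0.
  by rewrite entry_setmx !sub0set !set0D nmatch0 -setI_eq0 setI0 eqxx.
by move=> U nU; rewrite entry_setmx !subset0 (negbTE nU).
Qed.

Lemma chain_nbrs (t : 'I_L) (y : Y) (W : {set 'I_L * Y}) (F : 'I_L * Y -> R) :
  \sum_(z | chain (t, y) z && (z \in W)) F z =
  \sum_(y' | g y y' && (y' \in slice W t)) F (t, y') +
  (if (ord_pred t, y) \in W then F (ord_pred t, y) else 0) +
  (if (ordS t, y) \in W then F (ordS t, y) else 0).
Proof.
have [h1 h2 h3] := cyc_nbrs_neq t.
transitivity (\sum_u \sum_y' (if chain (t, y) (u, y') && ((u, y') \in W) then F (u, y') else 0)).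
  by rewrite pair_bigA big_mkcond; apply: eq_bigr => -[].
have one u : u != t -> cyc_adj t u ->
    \sum_y' (if chain (t, y) (u, y') && ((u, y') \in W) then F (u, y') else 0) =
    if (u, y) \in W then F (u, y) else 0.
  move=> nut ut; rewrite (bigD1 y) //= big1 ?addr0.
    by rewrite /chain /= ut eqxx orbT.
  by move=> y' ny; rewrite /chain /= eq_sym (negbTE nut) eq_sym (negbTE ny) andbF.
rewrite (bigD1 t) //= (bigD1 (ord_pred t)) //= (bigD1 (ordS t)) /=; last by rewrite h1 eq_sym h3.
have adj_p : cyc_adj t (ord_pred t) by rewrite cyc_adjE eqxx orbT.
have adj_s : cyc_adj t (ordS t) by rewrite cyc_adjE eqxx.
rewrite (one _ h2 adj_p) (one _ h1 adj_s) [X in _ + (_ + (_ + X))]big1 ?addr0 ?addrA.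
  congr (_ + _ + _); rewrite [RHS]big_mkcond /=; apply: eq_bigr => y' _.
  rewrite /slice inE /chain /= eqxx /= cyc_adjE ![t == _]eq_sym (negbTE h1) (negbTE h2). by rewrite /= orbF.
move=> u /andP[/andP[u1 u2] u3]; apply: big1 => y' _.
by rewrite /chain /= eq_sym (negbTE u1) cyc_adjE (negbTE u2) (negbTE u3).
Qed.

(** Both sides satisfy the same recursion: on the left a vertex is removed together with
    its partner; on the right [transfer_rec] at the slice of the vertex gives the three kinds
    of partners, the operators being absorbed by the neighbouring slices. *)
Lemma nmatch_chain W : (nmatch chain W)%:R = cyc_trace (fun t => T_ (slice W t)).
Proof.
have [n] := ubnP #|W|; elim: n W => // n IH W leW.
have [->|[[t y] xW]] := set_0Vmem W.
  rewrite nmatch0 /cyc_trace (eq_bigr (fun _ => T_ set0)); last first.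
    by move=> t _; congr T_; apply/setP => y; rewrite !inE.
  rewrite prodr_const card_ord; have := L_gt0; case: (L) => // m _.
  elim: m => [|m IHm]; first by rewrite expr1 transfer0_tr.
  by rewrite exprSr exprSr -mulrA transfer0_idem -exprSr.
have [h1 h2 h3] := cyc_nbrs_neq t.
rewrite (nmatch_rec chain_sym chain_irr xW) natr_sum.
rewrite (eq_bigr (fun z => cyc_trace (fun u => T_ (slice (W :\: [set (t, y); z]) u)))); last first.
  move=> z _; apply: IH; rewrite -ltnS; apply: leq_trans leW; rewrite ltnS.
  apply: proper_card; apply/properP; split; first exact: subsetDl.
  by exists (t, y) => //; rewrite !inE eqxx.
have yW : y \in slice W t by rewrite inE.
rewrite chain_nbrs [RHS](cyc_trace3 _ t) (transfer_rec R g_sym g_irr yW).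
set Q := far_prod _ t; set Tp := T_ (slice W (ord_pred t)); set Ts := T_ (slice W (ordS t)).
have other (z : 'I_L * Y) : [|| z.1 == t, z.1 == ord_pred t | z.1 == ordS t] ->
    far_prod (fun u => T_ (slice (W :\: [set (t, y); z]) u)) t = Q.
  move=> hz; apply: eq_far_prod => u u1 u2 u3; congr T_; apply/setP => y'.
  rewrite slice_del !inE; case: z hz => z1 z2 /= hz.
  rewrite /eq_op /= (negbTE u2) /=; case: (altP (u =P z1)) hz => [<-|]; last by rewrite andbT.
  by rewrite (negbTE u1) (negbTE u2) (negbTE u3).
have o0 (y' : Y) : [|| (t, y').1 == t, (t, y').1 == ord_pred t | (t, y').1 == ordS t] by rewrite /= eqxx.
have o1 : [|| (ord_pred t, y).1 == t, (ord_pred t, y).1 == ord_pred t | (ord_pred t, y).1 == ordS t].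
  by rewrite /= eqxx orbT.
have o2 : [|| (ordS t, y).1 == t, (ordS t, y).1 == ord_pred t | (ordS t, y).1 == ordS t].
  by rewrite /= eqxx !orbT.
have slD (z : 'I_L * Y) u : u != t -> slice (W :\: [set (t, y); z]) u = slice W u :\: [set y' | (u, y') == z].
  move=> nut; rewrite slice_del; apply/setP => y'; rewrite !inE /eq_op /= (negbTE nut) /=.
  by rewrite andbC.
have slt (z : 'I_L * Y) : z.1 != t -> slice (W :\: [set (t, y); z]) t = slice W t :\ y.
  move=> nut; rewrite slice_del; apply/setP => y'; rewrite !inE /eq_op /= eqxx /=.
  by rewrite [t == _]eq_sym (negbTE nut) andbT andbC.
rewrite !mulrDr !mulrDl !raddfD /=; congr (_ + _ + _).
- rewrite mulr_sumr !mulr_suml raddf_sum /=; apply: eq_bigr => y' _.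
  rewrite (cyc_trace3 _ t) (other (t, y') (o0 y')) (slD _ _ h2) (slD _ _ h1).
  have E u : u != t -> [set y0 | (u, y0) == (t, y')] = set0.
    by move=> nut; apply/setP => y0; rewrite !inE /eq_op /= (negbTE nut).
  rewrite (E _ h1) (E _ h2) !setD0.
  suff -> : slice (W :\: [set (t, y); (t, y')]) t = slice W t :\: [set y; y'] by [].
  apply/setP => y0; rewrite slice_del !inE /eq_op /= eqxx /= negb_or.
  by rewrite andbC.
- case: ifP => hW.
    rewrite (cyc_trace3 _ t) (other (ord_pred t, y) o1) (slt (ord_pred t, y) h2) (slD _ _ h2) (slD _ _ h1).
    have -> : [set y' | (ord_pred t, y') == (ord_pred t, y)] = [set y].
      by apply/setP => y'; rewrite !inE /eq_op /= eqxx.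
    have -> : [set y' | (ordS t, y') == (ord_pred t, y)] = set0.
      by apply/setP => y'; rewrite !inE /eq_op /= eq_sym (negbTE h3).
    by rewrite setD0 !mulrA transfer_createT // sub1set inE.
  by rewrite !mulrA transfer_createT0 ?mul0r ?mxtrace0 // sub1set inE hW.
- case: ifP => hW.
    rewrite (cyc_trace3 _ t) (other (ordS t, y) o2) (slt (ordS t, y) h1) (slD _ _ h2) (slD _ _ h1).
    have -> : [set y' | (ordS t, y') == (ordS t, y)] = [set y].
      by apply/setP => y'; rewrite !inE /eq_op /= eqxx.
    have -> : [set y' | (ord_pred t, y') == (ordS t, y)] = set0.
      by apply/setP => y'; rewrite !inE /eq_op /= (negbTE h3).
    by rewrite setD0 -!mulrA [create _ _ * (_ * _)]mulrA create_transfer // sub1set inE.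
  by rewrite -!mulrA [create _ _ * (_ * _)]mulrA create_transfer0 ?mul0r ?mulr0 ?mxtrace0 // sub1set inE hW.
Qed.

Lemma cyc_trace_one F (t : 'I_L) A : F t = A -> (forall u, u != t -> F u = T_ setT) ->
  cyc_trace F = \tr (A * T_ setT ^+ L.-1).
Proof.
move=> Ft Fu; rewrite (cyc_trace_rot F t) big_ltn; last by have := L_gt0; lia.
rewrite cyc_ord Ft; congr (\tr (_ * _)).
rewrite (eq_big_nat _ _ (F2 := fun _ => T_ setT)); last first.
  by move=> k hk; apply: Fu; rewrite -[X in _ != X]cyc_ord cyc_neq //; lia.
by rewrite prodr_const_nat; congr (_ ^+ _); have := L_gt0; lia.
Qed.

Lemma cyc_trace_two F (t : 'I_L) d A B : (0 < d < L)%N -> F t = A -> F (cyc (t + d)) = B ->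
  (forall u, u != t -> u != cyc (t + d) -> F u = T_ setT) ->
  cyc_trace F = \tr (A * T_ setT ^+ d.-1 * B * T_ setT ^+ (L - d.+1)).
Proof.
move=> hd Ft Fd Fu; rewrite (cyc_trace_rot F t) big_ltn; last by have := L_gt0; lia.
rewrite cyc_ord Ft (@big_cat_nat _ _ _ (t + d)) /=; [|lia|lia].
rewrite (@big_ltn _ _ _ (t + d)); last by lia.
rewrite Fd !mulrA; congr (\tr (_ * _ * _ * _)).
  rewrite (eq_big_nat _ _ (F2 := fun _ => T_ setT)).
    by rewrite prodr_const_nat; congr (_ ^+ _); lia.
  move=> k hk; apply: Fu; first by rewrite -[X in _ != X]cyc_ord cyc_neq //; lia.
  by rewrite eq_sym cyc_neq //; lia.
rewrite (eq_big_nat _ _ (F2 := fun _ => T_ setT)).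
  by rewrite prodr_const_nat; congr (_ ^+ _); lia.
move=> k hk; apply: Fu; first by rewrite -[X in _ != X]cyc_ord cyc_neq //; lia.
by rewrite cyc_neq //; lia.
Qed.

Definition at_slice (t : 'I_L) (X : {set Y}) : {set 'I_L * Y} := [set (t, y) | y in X].

Lemma in_at_slice t X u y : ((u, y) \in at_slice t X) = (u == t) && (y \in X).
Proof.
apply/imsetP/andP => [[y' yX [-> ->]]|[/eqP-> yX]]; first by rewrite eqxx.
by exists y.
Qed.

Lemma nmatch_full : (nmatch chain setT)%:R = \tr (T_ setT ^+ L).
Proof.
rewrite nmatch_chain (cyc_trace_one (t := cyc 0) (A := T_ setT)).
- by rewrite -exprS prednK // L_gt0.
- by congr T_; apply/setP => y; rewrite !inE.
- by move=> u _; congr T_; apply/setP => y; rewrite !inE.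
Qed.

Lemma nmatch_one_slice t X : (nmatch chain (~: at_slice t X))%:R = \tr (create R X * T_ setT ^+ L).
Proof.
rewrite nmatch_chain (cyc_trace_one (t := t) (A := create R X * T_ setT)).
- by rewrite -mulrA -exprS prednK // L_gt0.
- rewrite create_transfer ?subsetT //; congr T_; apply/setP => y.
  by rewrite !inE in_at_slice eqxx andbT.
- move=> u nut; congr T_; apply/setP => y.
  by rewrite !inE in_at_slice (negbTE nut).
Qed.

Lemma nmatch_two_slices t d X X' : (0 < d < L)%N ->
  (nmatch chain (~: (at_slice t X :|: at_slice (cyc (t + d)) X')))%:R =
  \tr (T_ (~: X) * T_ setT ^+ d.-1 * T_ (~: X') * T_ setT ^+ (L - d.+1)).
Proof.
move=> hd; have nd : cyc (t + d) != t by rewrite -[X in _ != X]cyc_ord cyc_neq //; lia.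
rewrite nmatch_chain (cyc_trace_two (t := t) (d := d) (A := T_ (~: X)) (B := T_ (~: X'))) //.
- by congr T_; apply/setP => y; rewrite !inE !in_at_slice eqxx eq_sym (negbTE nd) orbF.
- by congr T_; apply/setP => y; rewrite !inE !in_at_slice eqxx (negbTE nd).
move=> u u1 u2; congr T_; apply/setP => y.
by rewrite !inE !in_at_slice (negbTE u1) (negbTE u2).
Qed.

End Chain.

(** * Variance of staggered sums of edges *)

Section Variance.
Variables (R : realFieldType) (Y : finType) (g : rel Y).
Hypotheses (g_sym : symmetric g) (g_irr : irreflexive g).
Variables (N L : nat) (LN : (L = 2 * N)%N) (L3 : (2 < L)%N).
Notation mat := 'M[R]_#|{set Y}|.
Notation ch := (@chain Y g L).
Notation cycL := (cyc L3).
Notation T := (transfer R g setT).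
Notation atL := (@at_slice Y L).
Notation cre := (create R).

Lemma transferT_sym : T^T = T. Proof. exact: transfer_sym. Qed.

Lemma create_T X : cre X * T = transfer R g (~: X).
Proof. by rewrite create_transfer ?subsetT // setTD. Qed.

Lemma T_createT X : T * (cre X)^T = transfer R g (~: X).
Proof. by rewrite transfer_createT ?subsetT // setTD. Qed.

Lemma entry_TL_ge0 (S : {set Y}) : 0 <= entry (T ^+ L) S S.
Proof.
rewrite LN mulnC exprM expr2 entryM; apply: sumr_ge0 => U _.
by rewrite -[entry _ U S]entry_tr (exp_sym transferT_sym) -expr2 sqr_ge0.
Qed.

Lemma at_slice_edge t (X : {set Y}) : X \in edge_set g -> atL t X \in edge_set ch.
Proof.
move=> /edge_setP[x [y [exy ->]]]; apply/edge_setP; exists (t, x), (t, y).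
by rewrite /chain /= eqxx exy /at_slice imsetU1 imset_set1.
Qed.

Lemma at_slice_inj t : injective (atL t).
Proof. by move=> X X' E; apply/setP => y; move/setP/(_ (t, y)): E; rewrite !in_at_slice eqxx. Qed.

Lemma at_slice_disj t (X X' : {set Y}) : [disjoint atL t X & atL t X'] = [disjoint X & X'].
Proof.
rewrite -!setI_eq0 -imsetI; last by move=> ? ? _ _ [].
by rewrite imset_eq0.
Qed.

Lemma at_slice_neq t t' (X X' : {set Y}) : t != t' -> X != set0 ->
  [disjoint atL t X & atL t' X'] /\ atL t X != atL t' X'.
Proof.
move=> nt nX.
have d : [disjoint atL t X & atL t' X'].
  rewrite -setI_eq0; apply/eqP/setP => -[u y]; rewrite !inE !in_at_slice.
  by case: (u =P t) => [->|] //=; rewrite (negbTE nt) andbF.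
split=> //; apply: contraNneq nX => E; move: d; rewrite -E -setI_eq0 setIid.
by rewrite imset_eq0.
Qed.

Lemma edge_neq0 (X : {set Y}) : X \in edge_set g -> X != set0.
Proof. by move=> /edge_setP[x [y [_ ->]]]; apply/set0Pn; exists x; rewrite !inE eqxx. Qed.

Definition joint t t' X X' : R := (nmatch2 ch (atL t X) (atL t' X'))%:R.

Lemma joint_two t d X X' : (0 < d < L)%N -> X \in edge_set g -> X' \in edge_set g ->
  joint t (cycL (t + d)) X X' = \tr (cre X * T ^+ d * cre X' * T ^+ (L - d)).
Proof.
move=> hd eX eX'.
have nt : t != cycL (t + d) by rewrite eq_sym -[X in _ != X](cyc_ord L3) cyc_neq //; lia.
have [dX nX] := at_slice_neq X' nt (edge_neq0 eX).
rewrite /joint nmatch2E ?at_slice_edge // (negbTE nX) dX (nmatch_two_slices R g_sym g_irr) //.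
rewrite -!create_T; have -> : (L - d = (L - d.+1).+1)%N by lia.
have -> : T ^+ d = T * T ^+ d.-1 by rewrite -exprS prednK //; lia.
by rewrite exprS !mulrA.
Qed.

Lemma joint_same t X X' : X \in edge_set g -> X' \in edge_set g -> [disjoint X & X'] ->
  joint t t X X' = \tr (cre X * cre X' * T ^+ L).
Proof.
move=> eX eX' d.
rewrite /joint nmatch2E ?at_slice_edge // (inj_eq (@at_slice_inj t)) at_slice_disj d.
rewrite ifN; last first.
  by apply: contraTneq d => ->; rewrite -setI_eq0 setIid edge_neq0.
by rewrite /at_slice -imsetU (nmatch_one_slice R g_sym g_irr) // create_create.
Qed.

Lemma joint_diag t X : X \in edge_set g -> joint t t X X = \tr (cre X * T ^+ L).
Proof.
move=> eX.
by rewrite /joint nmatch2E ?at_slice_edge // eqxx (nmatch_one_slice R g_sym g_irr).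
Qed.

Lemma tr_create_edge_le X : X \in edge_set g -> \tr (cre X * T ^+ L) <= (nmatch ch setT)%:R.
Proof. by move=> eX; rewrite -(joint_diag (cycL 0)) // ler_nat nmatch2_le. Qed.

Variables (Q : finType) (X : Q -> {set Y}).
Hypotheses (eX : forall q, X q \in edge_set g).
Hypothesis dX : forall q q', q != q' -> [disjoint X q & X q'].

Definition edge_op (a : Q -> R) : mat := \sum_q a q *: cre (X q).

(** Annihilating on the right of a slice is creating on its left.  This is what turns
    occupation numbers of slices of both parities into one operator and its transpose. *)
Lemma edge_op_T a : edge_op a * T = T * (edge_op a)^T.
Proof.
rewrite /edge_op mulr_suml raddf_sum mulr_sumr; apply: eq_bigr => q _ /=.
by rewrite linearZ /= scaleMl scaleMr create_T T_createT.
Qed.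

(** An edge operator can be carried across one slice, becoming its transpose. *)
Lemma shiftL a d e M :
  \tr ((edge_op a)^T * T ^+ d * M * T ^+ e.+1) = \tr (edge_op a * T ^+ d.+1 * M * T ^+ e).
Proof.
rewrite tr_C [RHS]tr_C [T ^+ e.+1]exprSr [T ^+ d.+1]exprS -!mulrA.
by rewrite [T * ((edge_op a)^T * _)]mulrA -edge_op_T -mulrA.
Qed.

Lemma shiftR a d e M :
  \tr (M * T ^+ d.+1 * (edge_op a)^T * T ^+ e) = \tr (M * T ^+ d * edge_op a * T ^+ e.+1).
Proof.
rewrite [T ^+ d.+1]exprSr [T ^+ e.+1]exprS -!mulrA.
by rewrite [T * ((edge_op a)^T * _)]mulrA -edge_op_T -mulrA.
Qed.

(** The difference of the occupation numbers of an edge in slices [2 j] and [2 j + 1]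
    is represented by this antisymmetric operator. *)
Definition skew_op a := (edge_op a)^T - edge_op a.

Lemma skew_op_anti a : (skew_op a)^T = - skew_op a.
Proof. by rewrite /skew_op raddfB /= trmxK opprB. Qed.

Definition edge_loop a b d := \tr (edge_op a * T ^+ d * edge_op b * T ^+ (L - d)).

Lemma loop_skew a b d : (0 < d < L)%N ->
  - loop T d (L - d) (skew_op a) (skew_op b) = 2 * edge_loop a b d - edge_loop a b d.+1 - edge_loop a b d.-1.
Proof.
move=> hd; rewrite /loop skew_op_anti /skew_op.
rewrite !mulNr raddfN opprK !(mulrBl, mulrBr) !raddfB /=.
have E1 : \tr ((edge_op a)^T * T ^+ d * (edge_op b)^T * T ^+ (L - d)) = edge_loop a b d.
  by rewrite /edge_loop (_ : L - d = (L - d.+1).+1)%N ?shiftL ?shiftR //; lia.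
have E2 : \tr ((edge_op a)^T * T ^+ d * edge_op b * T ^+ (L - d)) = edge_loop a b d.+1.
  by rewrite /edge_loop (_ : L - d = (L - d.+1).+1)%N ?shiftL //; lia.
have E3 : \tr (edge_op a * T ^+ d * (edge_op b)^T * T ^+ (L - d)) = edge_loop a b d.-1.
  rewrite /edge_loop (_ : L - d.-1 = (L - d).+1)%N; last by lia.
  by rewrite -shiftR prednK //; lia.
rewrite E1 E2 E3 -/(edge_loop a b d); ring.
Qed.

Lemma loop_skew0 a : loop T 0 L (skew_op a) (skew_op a) =
  \tr (edge_op a * (edge_op a)^T * T ^+ L) + \tr ((edge_op a)^T * edge_op a * T ^+ L) - 2 * edge_loop a a 0.
Proof.
rewrite /loop skew_op_anti /skew_op opprB expr0 mulr1 /edge_loop expr0 mulr1 subn0.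
rewrite !(mulrBl, mulrBr) !raddfB /=.
have -> : \tr ((edge_op a)^T * (edge_op a)^T * T ^+ L) = \tr (edge_op a * edge_op a * T ^+ L).
  by rewrite -mxtrace_tr !trM (exp_sym transferT_sym) !trmxK tr_C.
ring.
Qed.

Lemma edge_loop1 a : edge_loop a a 1 = \tr ((edge_op a)^T * edge_op a * T ^+ L).
Proof.
rewrite /edge_loop (_ : T ^+ L = T ^+ (L - 1).+1); last by congr (_ ^+ _); lia.
by rewrite -shiftL expr0 mulr1.
Qed.

(** Only the terms with twice the same edge fail to commute, so the commutator has no
    cross terms. *)
Lemma commutator_le a :
  \tr (edge_op a * (edge_op a)^T * T ^+ L) - \tr ((edge_op a)^T * edge_op a * T ^+ L) <=
  (\sum_q a q ^+ 2) * \tr (T ^+ L).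
Proof.
rewrite -raddfB -mulrBl.
have -> : edge_op a * (edge_op a)^T - (edge_op a)^T * edge_op a =
    \sum_q a q ^+ 2 *: (cre (X q) * (cre (X q))^T - (cre (X q))^T * cre (X q)).
  have E1 : edge_op a * (edge_op a)^T = \sum_q \sum_q' (a q * a q') *: (cre (X q) * (cre (X q'))^T).
    rewrite /edge_op raddf_sum mulr_suml; apply: eq_bigr => q _; rewrite mulr_sumr.
    by apply: eq_bigr => q' _ /=; rewrite linearZ /= scaleMl scaleMr scalerA.
  have E2 : (edge_op a)^T * edge_op a = \sum_q \sum_q' (a q * a q') *: ((cre (X q'))^T * cre (X q)).
    rewrite /edge_op raddf_sum mulr_sumr; apply: eq_bigr => q _; rewrite mulr_suml.
    by apply: eq_bigr => q' _ /=; rewrite linearZ /= scaleMl scaleMr scalerA mulrC.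
  rewrite E1 E2 -sumrB; apply: eq_bigr => q _; rewrite -sumrB (bigD1 q) //= big1 ?addr0.
    by rewrite -scalerBr expr2.
  by move=> q' nq; rewrite create_comm ?subrr // dX // eq_sym.
rewrite !mulr_suml !raddf_sum /=; apply: ler_sum => q _.
rewrite scaleMl linearZ /= ler_wpM2l ?sqr_ge0 // mulrBl raddfB /= lerBlDr.
rewrite !entry_trace -big_split /=; apply: ler_sum => S _.
have D (P : {set Y} -> bool) (M : mat) : M = setmx (fun S S' => (P S && (S == S'))%:R) ->
    entry (M * T ^+ L) S S = (P S)%:R * entry (T ^+ L) S S.
  move=> ->; rewrite entryM (bigD1 S) //= big1 ?addr0; first by rewrite entry_setmx eqxx andbT.
  by move=> U nU; rewrite entry_setmx eq_sym (negbTE nU) andbF mul0r.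
rewrite (D _ _ (create_createT _ _)) (D _ _ (createT_create _ _)).
have h := entry_TL_ge0 S.
case: [disjoint S & _]; case: (X q \subset S); rewrite ?mul1r ?mul0r ?addr0 //; lra.
Qed.

Definition present (M : {set {set 'I_L * Y}}) t q : R := (atL t (X q) \in M)%:R.
Notation PM := (matchings ch setT).
Definition slice_form (a : Q -> R) M t : R := \sum_q a q * present M t q.

Lemma sum_present t t' q q' : \sum_(M in PM) present M t q * present M t' q' = joint t t' (X q) (X q').
Proof.
rewrite /joint /nmatch2 -sum1_card natr_sum big_mkcond [RHS]big_mkcond /=; apply: eq_bigr => M _.
by rewrite /present inE -natrM mulnb; case: (M \in PM) => //; case: (_ && _).
Qed.

Lemma sum_slice_form a b t t' : \sum_(M in PM) slice_form a M t * slice_form b M t' =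
  \sum_q \sum_q' a q * b q' * joint t t' (X q) (X q').
Proof.
rewrite (eq_bigr (fun M => \sum_q \sum_q' a q * b q' * (present M t q * present M t' q'))).
  rewrite exchange_big; apply: eq_bigr => q _; rewrite exchange_big; apply: eq_bigr => q' _.
  by rewrite -mulr_sumr sum_present.
move=> M _; rewrite /slice_form mulr_suml; apply: eq_bigr => q _; rewrite mulr_sumr.
by apply: eq_bigr => q' _; rewrite mulrACA.
Qed.

Lemma sum_slice_form_two a b t d : (0 < d < L)%N ->
  \sum_(M in PM) slice_form a M t * slice_form b M (cycL (t + d)) = edge_loop a b d.
Proof.
move=> hd; rewrite sum_slice_form /edge_loop {1}/edge_op !mulr_suml raddf_sum /=; apply: eq_bigr => q _.
rewrite /edge_op mulr_sumr mulr_suml raddf_sum /=; apply: eq_bigr => q' _.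
by rewrite joint_two // !(scaleMl, scaleMr) !mxtraceZ mulrA [b q' * _]mulrC.
Qed.

Lemma sum_slice_form_same a t :
  \sum_(M in PM) slice_form a M t * slice_form a M t = edge_loop a a 0 + \tr (edge_op (fun q => a q ^+ 2) * T ^+ L).
Proof.
rewrite sum_slice_form /edge_loop expr0 mulr1 subn0 {1 3}/edge_op !mulr_suml !raddf_sum /= -big_split /=.
apply: eq_bigr => q _; rewrite /edge_op mulr_sumr mulr_suml raddf_sum /= (bigD1 q) //= [in RHS](bigD1 q) //=.
rewrite joint_diag // !(scaleMl, scaleMr) create_create0 ?mul0r ?scaler0 ?mxtrace0 ?add0r; last first.
  by rewrite -setI_eq0 setIid edge_neq0.
rewrite addrC mxtraceZ expr2; congr (_ + _); apply: eq_bigr => q' nq.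
by rewrite joint_same ?dX 1?eq_sym // !(scaleMl, scaleMr) !mxtraceZ mulrA.
Qed.

(** The covariance of two different pairs of slices is minus the correlation of their
    skew operators, so by [loop_pos] the covariances add up to at most the sum of the
    self-correlations; together with the variances of the single pairs these are local
    ([commutator_le]). *)
Lemma staggered_variance (a : nat -> Q -> R) m : (2 * m <= N)%N ->
  \sum_(M in PM) (\sum_(j < m) (slice_form (a j) M (cycL (2 * j)) - slice_form (a j) M (cycL (2 * j).+1))) ^+ 2
  <= 3 * (\sum_(j < m) \sum_q a j q ^+ 2) * (nmatch ch setT)%:R.
Proof.
move=> hm; pose x M j := slice_form (a j) M (cycL (2 * j)) - slice_form (a j) M (cycL (2 * j).+1).
pose EE i j := \sum_(M in PM) x M i * x M j.
have L0 : (0 < L)%N by lia.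
have EEC i j : EE i j = EE j i by apply: eq_bigr => M _; rewrite mulrC.
have EE4 i j : EE i j =
   \sum_(M in PM) slice_form (a i) M (cycL (2 * i)) * slice_form (a j) M (cycL (2 * j))
  + \sum_(M in PM) slice_form (a i) M (cycL (2 * i).+1) * slice_form (a j) M (cycL (2 * j).+1)
  - \sum_(M in PM) slice_form (a i) M (cycL (2 * i)) * slice_form (a j) M (cycL (2 * j).+1)
  - \sum_(M in PM) slice_form (a j) M (cycL (2 * j)) * slice_form (a i) M (cycL (2 * i).+1).
  rewrite -big_split -!sumrB /=; apply: eq_bigr => M _; rewrite /x; ring.
have tw k k' (c c' : Q -> R) d : k' = (k + d)%N -> (0 < d < L)%N ->
    \sum_(M in PM) slice_form c M (cycL k) * slice_form c' M (cycL k') = edge_loop c c' d.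
  move=> -> hd; rewrite -(sum_slice_form_two _ _ (cycL k)) //; apply: eq_bigr => M _; congr (_ * slice_form _ _ _).
  by apply: val_inj => /=; rewrite modnDml.
pose dd (i j : nat) := ((i - j) + (j - i))%N.
pose cc i j := loop T (2 * dd i j) (2 * (N - dd i j)) (skew_op (a i)) (skew_op (a j)).
(* The four covariances form a second difference. *)
have off i j : (i < j)%N -> (j < m)%N -> EE i j = - cc i j.
  move=> hij hj; rewrite EE4 /cc (_ : 2 * (N - dd i j) = L - 2 * dd i j)%N; last by lia.
  rewrite loop_skew; last by rewrite /dd; lia.
  rewrite (tw _ _ _ _ (2 * dd i j)%N) //; [|rewrite /dd; lia|rewrite /dd; lia].
  rewrite (tw _ _ _ _ (2 * dd i j)%N) //; [|rewrite /dd; lia|rewrite /dd; lia].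
  rewrite (tw _ _ _ _ (2 * dd i j).+1) //; [|rewrite /dd; lia|rewrite /dd; lia].
  have -> : \sum_(M in PM) slice_form (a j) M (cycL (2 * j)) * slice_form (a i) M (cycL (2 * i).+1) =
            \sum_(M in PM) slice_form (a i) M (cycL (2 * i).+1) * slice_form (a j) M (cycL (2 * j)).
    by apply: eq_bigr => M _; rewrite mulrC.
  rewrite (tw _ _ _ _ (2 * dd i j).-1) //; [|rewrite /dd; lia|rewrite /dd; lia].
  ring.
have diag i : EE i i + cc i i <= 3 * (\sum_q a i q ^+ 2) * (nmatch ch setT)%:R.
  rewrite EE4 /cc (_ : dd i i = 0)%N ?muln0 ?subn0 -?LN; last by rewrite /dd; lia.
  rewrite !sum_slice_form_same loop_skew0 (tw _ _ _ _ 1%N) ?edge_loop1 ?addn1 //; last by lia.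
  have h := commutator_le (a i).
  have h2 : \tr (edge_op (fun q => a i q ^+ 2) * T ^+ L) <= (\sum_q a i q ^+ 2) * (nmatch ch setT)%:R.
    rewrite /edge_op !mulr_suml raddf_sum; apply: ler_sum => q _ /=.
    by rewrite scaleMl linearZ /= ler_wpM2l ?sqr_ge0 // tr_create_edge_le.
  rewrite -(nmatch_full R g_sym g_irr L3) in h; lra.
have ccC i j : cc i j = cc j i by rewrite /cc loop_sym ?transferT_sym // (_ : dd i j = dd j i) //; rewrite /dd; lia.
have EEE (i j : 'I_m) : EE i j = - cc i j + (if i == j then EE i i + cc i i else 0).
  case: eqP => [->|/eqP nij]; first by rewrite addrC addrK.
  rewrite addr0; case: (ltngtP i j) => hij; first exact: off.
    by rewrite EEC ccC off.
  by case/eqP: nij; apply: val_inj.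
have -> : \sum_(M in PM) (\sum_(j < m) x M j) ^+ 2 = \sum_(i < m) \sum_(j < m) EE i j.
  rewrite (eq_bigr (fun M => \sum_(i < m) \sum_(j < m) x M i * x M j)).
    by rewrite exchange_big; apply: eq_bigr => i _; rewrite exchange_big.
  by move=> M _; rewrite expr2 mulr_suml; apply: eq_bigr => i _; rewrite mulr_sumr.
have P : 0 <= \sum_(i < m) \sum_(j < m) cc i j.
  by apply: (@loop_pos _ _ _ _ transferT_sym (fun i => skew_op (a i))) => // i; apply: skew_op_anti.
have -> : \sum_(i < m) \sum_(j < m) EE i j =
   - (\sum_(i < m) \sum_(j < m) cc i j) + \sum_(i < m) (EE i i + cc i i).
  rewrite -sumrN -big_split; apply: eq_bigr => i _ /=; rewrite -sumrN.
  under eq_bigr => j _ do rewrite EEE.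
  rewrite big_split /=; congr (_ + _); rewrite -big_mkcond /= (big_pred1 i) //.
have : \sum_(i < m) (EE i i + cc i i) <= \sum_(i < m) 3 * (\sum_q a i q ^+ 2) * (nmatch ch setT)%:R.
  by apply: ler_sum => i _; apply: diag.
rewrite -mulr_suml -mulr_sumr; lra.
Qed.

End Variance.

(** * The slab torus as a chain of slices, in two ways *)

Lemma eqz_coord n (a b : 'I_n) (c : int) :
  (Defs.coord a == Defs.coord b + c %[mod n])%Z = (a%:Z == b%:Z + c %[mod n])%Z.
Proof. by rewrite /Defs.coord addrAC eqz_modDr. Qed.

Lemma coord0 n (a b : 'I_n) : (Defs.coord a == Defs.coord b %[mod n])%Z = (a == b).
Proof.
rewrite -[Defs.coord b]addr0 eqz_coord addr0 !modz_nat eqz_nat !modn_small //.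
Qed.

Lemma coordS n (a b : 'I_n) (s : bool) :
  (Defs.coord a == Defs.coord b + (-1) ^+ s %[mod n])%Z = if s then b == ordS a else a == ordS b.
Proof.
rewrite eqz_coord; case: s => /=.
  rewrite expr1 -(eqz_modDr 1) subrK eq_sym -PoszD addn1 !modz_nat eqz_nat.
  by rewrite [(b %% n)%N]modn_small.
by rewrite expr0 -PoszD addn1 !modz_nat eqz_nat [(a %% n)%N]modn_small.
Qed.

Lemma forall3 (P : pred 'I_3) :
  [forall j, P j] = [&& P ord0, P (inord 1) & P (inord 2)].
Proof.
apply/forallP/and3P => [h|[h0 h1 h2] j]; first by split.
case: (ltngtP j 1) => hj.
- by rewrite (_ : j = ord0) //; apply: val_inj => /=; lia.
- by rewrite (_ : j = inord 2) //; apply: val_inj; rewrite /= inordK //; have := ltn_ord j; lia.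
- by rewrite (_ : j = inord 1) //; apply: val_inj; rewrite /= inordK.
Qed.

Lemma exists3 (P : pred 'I_3) :
  [exists j, P j] = [|| P ord0, P (inord 1) | P (inord 2)].
Proof. by apply: negb_inj; rewrite negb_exists forall3 !negb_or. Qed.

Lemma existsb (P : pred bool) : [exists s, P s] = P false || P true.
Proof.
apply/existsP/orP => [[[] ->]|[h|h]]; first by right.
- by left.
- by exists false.
- by exists true.
Qed.

Lemma slabE L K (u v : vertex L K) : slab_torus u v =
  (u != v) && [|| cyc_adj u.1.1 v.1.1 && ((u.1.2 == v.1.2) && (u.2 == v.2)),
                (u.1.1 == v.1.1) && (cyc_adj u.1.2 v.1.2 && (u.2 == v.2)) |
                (u.1.1 == v.1.1) && ((u.1.2 == v.1.2) && cyc_adj u.2 v.2)].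
Proof.
rewrite /slab_torus; congr (_ && _).
rewrite exists3 !existsb !forall3 /pos /period.
have E1 : nat_of_ord (inord 1 : 'I_3) = 1%N by rewrite inordK.
have E2 : nat_of_ord (inord 2 : 'I_3) = 2%N by rewrite inordK.
have N01 : (ord0 == inord 1 :> 'I_3) = false by rewrite -val_eqE /= E1.
have N02 : (ord0 == inord 2 :> 'I_3) = false by rewrite -val_eqE /= E2.
have N12 : (inord 1 == inord 2 :> 'I_3) = false by rewrite -val_eqE /= E1 E2.
rewrite !E1 !E2 /= !eqxx ![inord _ == ord0]eq_sym ![inord 2 == inord 1]eq_sym N01 N02 N12 /=.
rewrite !mulr0 !mulr1 !addr0 !coord0 !(coordS _ _ false) !(coordS _ _ true) /cyc_adj.
by do 9?[case: (_ == _) => //=].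
Qed.

(** The first conjunct excludes the loop of a cycle of length one. *)
Definition slice_rel (L K : nat) : rel ('I_L * 'I_K) := fun y z =>
  (y != z) && (cyc_adj y.1 z.1 && (y.2 == z.2) || (y.1 == z.1) && cyc_adj y.2 z.2).

Lemma slice_sym L K : symmetric (@slice_rel L K).
Proof. by move=> y z; rewrite /slice_rel eq_sym ![cyc_adj y.1 _]cyc_adj_sym ![y.2 == _]eq_sym ![y.1 == _]eq_sym ![cyc_adj y.2 _]cyc_adj_sym. Qed.

Lemma slice_irr L K : irreflexive (@slice_rel L K).
Proof. by move=> y; rewrite /slice_rel eqxx. Qed.

Section Torus.
Variables (L K : nat) (L3 : (2 < L)%N).
Notation st := (@slab_torus L K).
Notation Y := ('I_L * 'I_K)%type.
Notation ch := (@chain Y (@slice_rel L K) L).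

Lemma cyc_adj_irr (a : 'I_L) : cyc_adj a a = false.
Proof. by rewrite cyc_adjE //; have [h1 h2 _] := cyc_nbrs_neq L3 a; rewrite ![a == _]eq_sym (negbTE h1) (negbTE h2). Qed.

Lemma slab_sym : symmetric st.
Proof.
move=> u v; rewrite !slabE eq_sym ![cyc_adj u.1.1 _]cyc_adj_sym ![cyc_adj u.1.2 _]cyc_adj_sym ![cyc_adj u.2 _]cyc_adj_sym.
by rewrite ![u.1.1 == _]eq_sym ![u.1.2 == _]eq_sym ![u.2 == _]eq_sym.
Qed.

Lemma slab_irr : irreflexive st.
Proof. by move=> u; rewrite slabE eqxx. Qed.

(** The slab is a chain of slices in each of its two long directions. *)
Definition split1 (u : vertex L K) : 'I_L * Y := (u.1.1, (u.1.2, u.2)).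
Definition split2 (u : vertex L K) : 'I_L * Y := (u.1.2, (u.1.1, u.2)).

Lemma split1_bij : bijective split1.
Proof. by exists (fun z => ((z.1, z.2.1), z.2.2)) => [[[]]|[? []]]. Qed.

Lemma split2_bij : bijective split2.
Proof. by exists (fun z => ((z.2.1, z.1), z.2.2)) => [[[]]|[? []]]. Qed.

Lemma split1_iso u v : ch (split1 u) (split1 v) = st u v.
Proof.
case: u v => [[a b] d] [[a' b'] d']; rewrite slabE /chain /slice_rel /split1 /=.
rewrite !xpair_eqE.
case: (altP (a =P a')) => [->|na] /=; last by rewrite !orbF.
by rewrite cyc_adj_irr /= orbF.
Qed.

Lemma split2_iso u v : ch (split2 u) (split2 v) = st u v.
Proof.
case: u v => [[a b] d] [[a' b'] d']; rewrite slabE /chain /slice_rel /split2 /=.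
rewrite !xpair_eqE.
case: (altP (b =P b')) => [->|nb] /=.
  by rewrite cyc_adj_irr /=; case: (a == a'); case: (d == d'); rewrite ?andbF ?andbT ?orbF.
by case: (a == a'); case: (d == d'); rewrite ?andbF ?andbT ?orbF.
Qed.

Lemma cyc_adj_S n (a b : 'I_n) : cyc_adj (ordS a) (ordS b) = cyc_adj a b.
Proof. by rewrite /cyc_adj !(inj_eq (can_inj (@ordSK n))). Qed.

End Torus.

Lemma second_moment (R : realFieldType) (V : finType) (e : rel V) (I : finType)
    (c : I -> R) (E : I -> {set V}) :
  \sum_(M in matchings e setT) (\sum_i c i * (E i \in M)%:R) ^+ 2 =
  \sum_i \sum_j c i * c j * (nmatch2 e (E i) (E j))%:R.
Proof.
rewrite (eq_bigr (fun M : {set {set V}} => \sum_i \sum_j c i * c j * ((E i \in M) && (E j \in M))%:R)).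
  rewrite exchange_big; apply: eq_bigr => i _; rewrite exchange_big; apply: eq_bigr => j _.
  rewrite -mulr_sumr; congr (_ * _); rewrite /nmatch2 -sum1_card natr_sum.
  rewrite big_mkcond [RHS]big_mkcond /=; apply: eq_bigr => M _.
  by rewrite inE; case: (M \in matchings _ _) => //; case: (_ && _).
move=> M _; rewrite expr2 mulr_suml; apply: eq_bigr => i _; rewrite mulr_sumr.
by apply: eq_bigr => j _; rewrite mulrACA -natrM mulnb.
Qed.

(** A second moment only depends on counts of pairs of edges, so it can be computed
    in any isomorphic graph. *)
Lemma second_moment_iso (R : realFieldType) (V V' : finType) (e : rel V) (e' : rel V') (h : V -> V') :
  symmetric e -> irreflexive e -> symmetric e' -> irreflexive e' ->
  bijective h -> (forall x y, e' (h x) (h y) = e x y) ->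
  forall (I : finType) (c : I -> R) (E : I -> {set V}), (forall i, E i \in edge_set e) ->
  \sum_(M in matchings e setT) (\sum_i c i * (E i \in M)%:R) ^+ 2 =
  \sum_(M in matchings e' setT) (\sum_i c i * (h @: E i \in M)%:R) ^+ 2.
Proof.
move=> s i s' i' bh hE I c E eE; rewrite !second_moment.
by apply: eq_bigr => j _; apply: eq_bigr => k _; rewrite (nmatch2_iso s i s' i' bh hE).
Qed.

Lemma sum_pairs (R : zmodType) (F : nat -> R) N :
  \sum_(t < 2 * N) F t = \sum_(j < N) (F (2 * j)%N + F (2 * j).+1).
Proof.
elim: N => [|N IH]; first by rewrite muln0 !big_ord0.
by rewrite mulnS !big_ord_recr /= IH -addrA.
Qed.

(** Pairs of consecutive integers on a cycle of length [2 * N]; pair [0] follows pair [N.-1]. *)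
Definition prev_pair (N j : nat) := if j is j'.+1 then j' else N.-1.

Lemma prev_pair_lt N (j : 'I_N) : (prev_pair N j < N)%N.
Proof. by case: j => -[|j] /= hj; lia. Qed.

Section Torus.
Variables (R : realFieldType) (L K N : nat) (L3 : (2 < L)%N) (LN : (L = 2 * N)%N).
Notation st := (@slab_torus L K).
Notation Y := ('I_L * 'I_K)%type.
Notation sr := (@slice_rel L K).
Notation ch := (@chain Y sr L).
Notation cycL := (cyc L3).
Notation PM := (matchings st setT).
Notation D := ((nmatch st setT)%:R : R).
Notation Q := ('I_N * 'I_K)%type.

(** The edge joining the pair of columns before the [q.1]-th to that pair. *)
Definition odd_edge (q : Q) : {set Y} :=
  [set (ord_pred (cycL (2 * q.1)), q.2); (cycL (2 * q.1), q.2)].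

Lemma cyc_inj k k' : (k < L)%N -> (k' < L)%N -> cycL k = cycL k' -> k = k'.
Proof. by move=> h h' /(congr1 val) /=; rewrite !modn_small. Qed.

Lemma ord_pred_S k : ord_pred (cycL k.+1) = cycL k.
Proof. by rewrite -ordS_cyc ordSK. Qed.

Lemma ord_pred_0 : ord_pred (cycL 0) = cycL L.-1.
Proof. by rewrite ord_pred_cyc -(add0n L.-1); apply: val_inj; rewrite /= mod0n. Qed.

Lemma odd_edge_edge q : odd_edge q \in edge_set sr.
Proof.
apply/edge_setP; eexists; eexists; split; last by [].
rewrite /slice_rel /= eqxx andbT xpair_eqE eqxx andbT cyc_adjE // ord_predK eqxx /= andbT.
by have [_ -> _] := cyc_nbrs_neq L3 (cycL (2 * q.1)).
Qed.

Lemma ord_pred_even (j : 'I_N) : ord_pred (cycL (2 * j)) = cycL (2 * prev_pair N j).+1.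
Proof.
case: j => -[|j] hj /=.
  by rewrite muln0 ord_pred_0; congr cycL; lia.
by rewrite mulnS ord_pred_S.
Qed.

Lemma cyc_even (j : 'I_N) : cycL (2 * j) = (2 * j)%N :> nat.
Proof. by rewrite /= modn_small //; have := ltn_ord j; lia. Qed.
Lemma cyc_odd (j : 'I_N) : cycL (2 * j).+1 = (2 * j).+1 :> nat.
Proof. by rewrite /= modn_small //; have := ltn_ord j; lia. Qed.

Lemma sum_cyc_pairs (G : 'I_L -> R) :
  \sum_t G t = \sum_(j < N) (G (cycL (2 * j)) + G (cycL (2 * j).+1)).
Proof.
rewrite -(sum_pairs (fun k => G (cycL k))) -LN.
by apply: eq_bigr => t _; rewrite cyc_ord.
Qed.

Lemma odd_edge_disj q q' : q != q' -> [disjoint odd_edge q & odd_edge q'].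
Proof.
case: q q' => [i w] [i' w'] nq; rewrite -setI_eq0; apply/eqP/setP => -[u v].
rewrite !inE /= !xpair_eqE; apply/negP => /andP[].
rewrite !ord_pred_even -!andb_orl => /andP[h1 /eqP ->] /andP[h2 /eqP ww].
case/negP: nq; rewrite xpair_eqE ww eqxx andbT; apply/eqP; apply: val_inj => /=.
have hi := ltn_ord i; have hi' := ltn_ord i'.
have hp (k : 'I_N) : ((2 * prev_pair N k).+1 < L)%N by rewrite /prev_pair; case: k => -[|k] /=; lia.
have hpi := hp i; have hpi' := hp i'.
have pinj : prev_pair N i = prev_pair N i' -> val i = val i'.
  by rewrite /prev_pair; case: (i) hi => -[|k] /= hk; case: (i') hi' => -[|k'] /= hk'; lia.
case/orP: h1 => /eqP e1; case/orP: h2 => /eqP e2; rewrite e1 in e2; move/cyc_inj: e2 => e2.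
- by apply: pinj; have := e2 hpi hpi'; lia.
- by have := e2 hpi; lia.
- by have := e2; lia.
- by have := e2; lia.
Qed.

Definition edge2 (t : 'I_L) (q : Q) : {set vertex L K} :=
  [set ((t, ord_pred (cycL (2 * q.1))), q.2); ((t, cycL (2 * q.1)), q.2)].
Definition edge1 (u : 'I_L) (q : Q) : {set vertex L K} :=
  [set ((ord_pred (cycL (2 * q.1)), u), q.2); ((cycL (2 * q.1), u), q.2)].

Lemma split1_edge t q : @split1 L K @: edge2 t q = at_slice t (odd_edge q).
Proof. by rewrite /edge2 /at_slice /odd_edge !imsetU1 !imset_set1. Qed.

Lemma split2_edge u q : @split2 L K @: edge1 u q = at_slice u (odd_edge q).
Proof. by rewrite /edge1 /at_slice /odd_edge !imsetU1 !imset_set1. Qed.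

Lemma iso_edge (h : vertex L K -> 'I_L * Y) (f : {set vertex L K}) : bijective h ->
  (forall x y, ch (h x) (h y) = st x y) -> h @: f \in edge_set ch -> f \in edge_set st.
Proof.
move=> bh hE /edge_setP[x [y [exy E]]]; have [k hk kh] := bh.
apply/edge_setP; exists (k x), (k y); rewrite -hE !kh; split=> //.
apply: (imset_inj (bij_inj bh)); by rewrite E imsetU1 imset_set1 !kh.
Qed.

(** [staggered_variance] along either long direction, for the edges that join two
    consecutive pairs in the other one. *)
Lemma torus_variance (h : vertex L K -> 'I_L * Y) (ed : 'I_L -> Q -> {set vertex L K})
   (a : nat -> Q -> R) m : bijective h ->
  (forall x y, ch (h x) (h y) = st x y) -> (forall t q, h @: ed t q = at_slice t (odd_edge q)) ->
  (2 * m <= N)%N -> (forall j q, (m <= j)%N -> a j q = 0) ->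
  \sum_(M in PM) (\sum_(j < N) \sum_q a j q *
      ((ed (cycL (2 * j)) q \in M)%:R - (ed (cycL (2 * j).+1) q \in M)%:R)) ^+ 2
  <= 3 * (\sum_(j < N) \sum_q a j q ^+ 2) * D.
Proof.
move=> bh hE hed hm a0.
have ss : symmetric st by exact: slab_sym.
have si : irreflexive st by exact: slab_irr.
have cs : symmetric ch by apply: chain_sym; apply: slice_sym.
have ci : irreflexive ch by apply: (chain_irr (@slice_irr L K)).
have mN : (m <= N)%N by lia.
have restr (F : nat -> R) : (forall j, (m <= j)%N -> F j = 0) -> \sum_(j < N) F j = \sum_(j < m) F j.
  move=> F0; rewrite -!(big_mkord xpredT F) (@big_cat_nat _ _ _ m) //= [X in _ + X]big_nat_cond.
  by rewrite [X in _ + X]big1 ?addr0 // => j /andP[/andP[h1 _] _]; apply: F0.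
rewrite [X in _ <= _ * X * _](restr (fun j => \sum_q a j q ^+ 2)); last first.
  by move=> j hj; apply: big1 => q _; rewrite a0 // expr0n.
have := @staggered_variance R Y sr (@slice_sym L K) (@slice_irr L K) N L LN L3 Q odd_edge odd_edge_edge odd_edge_disj a m hm.
have <- : nmatch st setT = nmatch ch setT.
  rewrite -(nmatch_iso ss si cs ci bh hE); congr nmatch; apply/setP => z; have [k hk kh] := bh.
  by rewrite inE; apply/imsetP; exists (k z).
apply: le_trans; rewrite le_eqVlt; apply/orP; left; apply/eqP.
pose I := ('I_m * bool * Q)%type.
pose c (i : I) : R := a i.1.1 i.2 * (if i.1.2 then -1 else 1).
pose E (i : I) := ed (cycL (if i.1.2 then (2 * i.1.1).+1 else (2 * i.1.1)%N)) i.2.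
have eE i : E i \in edge_set st.
  by apply: (iso_edge bh hE); rewrite hed at_slice_edge // odd_edge_edge.
transitivity (\sum_(M in PM) (\sum_i c i * (E i \in M)%:R) ^+ 2).
  apply: eq_bigr => M _; congr (_ ^+ 2).
  rewrite (restr (fun j => \sum_q a j q *
      ((ed (cycL (2 * j)) q \in M)%:R - (ed (cycL (2 * j).+1) q \in M)%:R))).
    rewrite -(pair_bigA _ (fun (p : 'I_m * bool) (q : Q) => c (p, q) * (E (p, q) \in M)%:R)) /=.
    rewrite -(pair_bigA _ (fun (j : 'I_m) (b : bool) => \sum_q c (j, b, q) * (E (j, b, q) \in M)%:R)) /=.
    apply: eq_bigr => j _; rewrite big_bool /= -big_split /=; apply: eq_bigr => q _.
    by rewrite /c /E /=; ring.
  by move=> j hj; apply: big1 => q _; rewrite a0 // mul0r.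
rewrite (second_moment_iso ss si cs ci bh hE) //; apply: eq_bigr => M _; congr (_ ^+ 2).
rewrite -(pair_bigA _ (fun (p : 'I_m * bool) (q : Q) => c (p, q) * (h @: E (p, q) \in M)%:R)) /=.
rewrite -(pair_bigA _ (fun (j : 'I_m) (b : bool) => \sum_q c (j, b, q) * (h @: E (j, b, q) \in M)%:R)) /=.
apply: eq_bigr => j _; rewrite big_bool /= /slice_form -sumrB -big_split /=; apply: eq_bigr => q _.
by rewrite /c /E /= !hed /present; ring.
Qed.

End Torus.

(** * Conservation of the staggered flow *)

Lemma cyc_adj_odd n (a b : 'I_n) : is_side n -> a != b -> cyc_adj a b -> odd a != odd b.
Proof.
have S (c d : 'I_n) : is_side n -> c != d -> c = ordS d -> odd c != odd d.
  rewrite /is_side => hn ncd E; have Ev : nat_of_ord c = (d.+1 %% n)%N by rewrite E.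
  have hd := ltn_ord d; have hc := ltn_ord c.
  case/orP: hn => [/eqP n1|/andP[n0 en]].
    by case/negP: ncd; apply/eqP; apply: val_inj => /=; lia.
  have [h|h] := ltnP d.+1 n.
    by move: Ev; rewrite modn_small // => ->; rewrite /=; case: (odd d).
  have En : d.+1 = n by lia.
  have Z : (d.+1 %% n = 0)%N by rewrite En modnn.
  rewrite Ev Z; have hod: odd d by lia. by rewrite hod.
move=> hn nab /orP[/eqP h|/eqP h]; first exact: S.
by rewrite eq_sym; apply: S => //; rewrite eq_sym.
Qed.

Lemma half_even (j : nat) : (2 * j)./2 = j. Proof. lia. Qed.
Lemma half_odd (j : nat) : (2 * j).+1./2 = j. Proof. lia. Qed.

Lemma sgn_even (R : pzRingType) (j : nat) : (-1) ^+ (2 * j) = 1 :> R.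
Proof. by rewrite exprM sqrrN expr1n expr1n. Qed.
Lemma sgn_odd (R : pzRingType) (j : nat) : (-1) ^+ (2 * j).+1 = -1 :> R.
Proof. by rewrite exprS sgn_even mulr1. Qed.

Section Ward.
Variables (R : realFieldType) (L K N : nat) (L3 : (2 < L)%N) (LN : (L = 2 * N)%N).
Hypothesis sideK : is_side K.
Notation V := (vertex L K).
Notation st := (@slab_torus L K).
Notation cycL := (cyc L3).
Notation PM := (matchings st setT).
Notation D := ((nmatch st setT)%:R : R).
Notation Q := ('I_N * 'I_K)%type.

Definition next1 (x : V) : V := ((ordS x.1.1, x.1.2), x.2).
Definition prev1 (x : V) : V := ((ord_pred x.1.1, x.1.2), x.2).
Definition next2 (x : V) : V := ((x.1.1, ordS x.1.2), x.2).
Definition prev2 (x : V) : V := ((x.1.1, ord_pred x.1.2), x.2).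
Definition vertical (x y : V) : bool := [&& x.1 == y.1, x.2 != y.2 & cyc_adj x.2 y.2].

Lemma slab_nbrs x (F : V -> R) : \sum_(y | st x y) F y =
  F (next1 x) + F (prev1 x) + F (next2 x) + F (prev2 x) + \sum_(y | vertical x y) F y.
Proof.
have one z : F z = \sum_y (if y == z then F y else 0).
  by rewrite -big_mkcond /= big_pred1_eq.
rewrite (one (next1 x)) (one (prev1 x)) (one (next2 x)) (one (prev2 x)) big_mkcond.
rewrite [in X in _ + X]big_mkcond -!big_split /=; apply: eq_bigr => y _.
have [h1 h2 h3] := cyc_nbrs_neq L3 x.1.1; have [k1 k2 k3] := cyc_nbrs_neq L3 x.1.2.
rewrite slabE /next1 /prev1 /next2 /prev2 /vertical.
case: x y h1 h2 h3 k1 k2 k3 => [[t u] w] [[t' u'] d] /= h1 h2 h3 k1 k2 k3.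
rewrite !xpair_eqE ![t' == _]eq_sym ![u' == _]eq_sym ![d == _]eq_sym.
case: (altP (t =P t')) => [E|nt].
  rewrite -E cyc_adj_irr // (negbTE h1) (negbTE h2) /= !add0r.
  case: (altP (u =P u')) => [E'|nu].
    by rewrite -E' cyc_adj_irr // (negbTE k1) (negbTE k2) /= !add0r; case: (w == d).
  rewrite /= orbF addr0 cyc_adjE // [u' == _]eq_sym [u' == ord_pred _]eq_sym.
  case: (altP (ordS u =P u')) => [<-|_] /=.
    by rewrite (negbTE k3) /= addr0.
  by rewrite add0r.
rewrite /= orbF !addr0 cyc_adjE // [t' == _]eq_sym [t' == ord_pred _]eq_sym.
case: (altP (ordS t =P t')) => [<-|_] /=.
  by rewrite (negbTE h3) /= addr0.
by rewrite add0r andbA.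
Qed.

Lemma sum_vertices (F : V -> R) : \sum_x F x = \sum_(j < N) \sum_(i < N) \sum_w
  (F ((cycL (2 * j), cycL (2 * i)), w) + F ((cycL (2 * j), cycL (2 * i).+1), w) +
   (F ((cycL (2 * j).+1, cycL (2 * i)), w) + F ((cycL (2 * j).+1, cycL (2 * i).+1), w))).
Proof.
have sp := @sum_cyc_pairs R L N L3 LN.
transitivity (\sum_t \sum_u \sum_w F ((t, u), w)).
  rewrite (pair_bigA _ (fun t u => \sum_w F ((t, u), w))) /=.
  rewrite (pair_bigA _ (fun p w => F ((p.1, p.2), w))) /=.
  by apply: eq_bigr => -[[]].
rewrite sp; apply: eq_bigr => j _; rewrite !sp -big_split; apply: eq_bigr => i _ /=.
by rewrite -!big_split.
Qed.

Variable Phi : nat -> nat -> R.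
(** Alternating signs and an amplitude that is constant on blocks of two by two
    columns: the edges inside a block and the vertical ones do not contribute to
    [matching_weight]. *)
Definition psi (x : V) : R := (-1) ^+ (x.1.1 + x.1.2 + x.2) * Phi x.1.1./2 x.1.2./2.
Definition occ (M : {set {set V}}) (f : {set V}) : R := (f \in M)%:R.

Lemma psiE (t u : 'I_L) w :
  psi ((t, u), w) = (-1) ^+ t * (-1) ^+ u * (-1) ^+ w * Phi t./2 u./2.
Proof. by rewrite /psi !exprD. Qed.

Lemma psi_ee (j i : 'I_N) w : psi ((cycL (2 * j), cycL (2 * i)), w) = (-1) ^+ w * Phi j i.
Proof. by rewrite psiE !(cyc_even L3 LN) !half_even !sgn_even !mul1r. Qed.
Lemma psi_eo (j i : 'I_N) w : psi ((cycL (2 * j), cycL (2 * i).+1), w) = - ((-1) ^+ w * Phi j i).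
Proof. by rewrite psiE (cyc_even L3 LN) (cyc_odd L3 LN) half_even half_odd sgn_even sgn_odd mul1r !mulN1r !mulNr. Qed.
Lemma psi_oe (j i : 'I_N) w : psi ((cycL (2 * j).+1, cycL (2 * i)), w) = - ((-1) ^+ w * Phi j i).
Proof. by rewrite psiE (cyc_even L3 LN) (cyc_odd L3 LN) half_even half_odd sgn_even sgn_odd mulr1 !mulN1r !mulNr. Qed.
Lemma psi_oo (j i : 'I_N) w : psi ((cycL (2 * j).+1, cycL (2 * i).+1), w) = (-1) ^+ w * Phi j i.
Proof. by rewrite psiE !(cyc_odd L3 LN) !half_odd !sgn_odd mulrNN mulr1 mul1r. Qed.

Lemma psi_sum : \sum_x psi x = 0.
Proof.
rewrite sum_vertices; apply: big1 => j _; apply: big1 => i _; apply: big1 => w _.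
by rewrite psi_ee psi_eo psi_oe psi_oo; ring.
Qed.

Lemma prev1K : cancel prev1 next1.
Proof. by move=> [[t u] w]; rewrite /prev1 /next1 /= ord_predK. Qed.
Lemma next1K : cancel next1 prev1.
Proof. by move=> [[t u] w]; rewrite /prev1 /next1 /= ordSK. Qed.
Lemma prev2K : cancel prev2 next2.
Proof. by move=> [[t u] w]; rewrite /prev2 /next2 /= ord_predK. Qed.
Lemma next2K : cancel next2 prev2.
Proof. by move=> [[t u] w]; rewrite /prev2 /next2 /= ordSK. Qed.

(** The flow in one direction, written as a sum over edges instead of vertices. *)
Lemma flow_dir (p n : V -> V) (G : V -> V -> R) : cancel p n -> cancel n p -> (forall x y, G x y = G y x) ->
  \sum_x (psi x * G x (n x) + psi x * G x (p x)) = \sum_x (psi (p x) + psi x) * G (p x) x.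
Proof.
move=> pn np GC; rewrite big_split /= (reindex p) /=; last by apply: onW_bij; exists n.
rewrite -big_split; apply: eq_bigr => x _ /=; by rewrite pn [G x _]GC mulrDl.
Qed.

(** The sign changes along every vertical edge. *)
Lemma vertical_flow0 (G : V -> V -> R) : (forall x y, G x y = G y x) ->
  \sum_x \sum_(y | vertical x y) psi x * G x y = 0.
Proof.
move=> GC; set S := LHS.
have vC x y : vertical x y = vertical y x by rewrite /vertical eq_sym [x.2 == _]eq_sym cyc_adj_sym.
have : S = - S.
  rewrite {1}/S; rewrite (eq_bigr (fun x => \sum_y (if vertical x y then psi x * G x y else 0))); last first.
    by move=> x _; rewrite big_mkcond.
  rewrite exchange_big /S -sumrN; apply: eq_bigr => x _ /=; rewrite -big_mkcond /= -sumrN.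
  rewrite (eq_bigl (vertical x)); last by move=> y; rewrite vC.
  apply: eq_bigr => y xy; rewrite GC -mulNr; congr (_ * _).
  case: x y xy => [x w] [y d]; rewrite /vertical /= => /and3P[/eqP <- nwd wd].
  rewrite /psi /= !exprD -mulNr -mulrN; congr (_ * _ * _).
  have := cyc_adj_odd sideK nwd wd.
  by rewrite -[in RHS]signr_odd -[in LHS]signr_odd; case: (odd w); case: (odd d); rewrite ?opprK.
by move/eqP; rewrite -addr_eq0 -mulr2n mulrn_eq0 /= => /eqP.
Qed.

Lemma flow_conservation M : M \in PM ->
  \sum_x (psi (prev1 x) + psi x) * occ M [set prev1 x; x] +
  \sum_x (psi (prev2 x) + psi x) * occ M [set prev2 x; x] = 0.
Proof.
move=> hM; pose G x y := occ M [set x; y].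
have GC x y : G x y = G y x by rewrite /G setUC.
rewrite -(flow_dir prev1K next1K GC) -(flow_dir prev2K next2K GC) -big_split /=.
rewrite -[RHS]psi_sum -(matching_weight (@slab_sym L K) (@slab_irr L K) psi hM).
rewrite -[LHS]addr0 -[X in _ + X = _](vertical_flow0 GC)  -big_split; apply: eq_bigr => x _ /=.
by rewrite slab_nbrs !addrA.
Qed.

Definition dif1 (j i : nat) : R := Phi j i - Phi (prev_pair N j) i.
Definition dif2 (j i : nat) : R := Phi j i - Phi j (prev_pair N i).

Notation edge1L := (@edge1 L K N L3).
Notation edge2L := (@edge2 L K N L3).

Lemma prev1E t u w : prev1 ((t, u), w) = ((ord_pred t, u), w). Proof. by []. Qed.
Lemma prev2E t u w : prev2 ((t, u), w) = ((t, ord_pred u), w). Proof. by []. Qed.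

Lemma psi1_ee (j i : 'I_N) w :
  psi (prev1 ((cycL (2 * j), cycL (2 * i)), w)) = - ((-1) ^+ w * Phi (prev_pair N j) i).
Proof. by rewrite prev1E ord_pred_even //; apply: (psi_oe (Ordinal (prev_pair_lt j))). Qed.
Lemma psi1_eo (j i : 'I_N) w :
  psi (prev1 ((cycL (2 * j), cycL (2 * i).+1), w)) = (-1) ^+ w * Phi (prev_pair N j) i.
Proof. by rewrite prev1E ord_pred_even //; apply: (psi_oo (Ordinal (prev_pair_lt j))). Qed.
Lemma psi1_oe (j i : 'I_N) w :
  psi (prev1 ((cycL (2 * j).+1, cycL (2 * i)), w)) = (-1) ^+ w * Phi j i.
Proof. by rewrite prev1E ord_pred_S psi_ee. Qed.
Lemma psi1_oo (j i : 'I_N) w :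
  psi (prev1 ((cycL (2 * j).+1, cycL (2 * i).+1), w)) = - ((-1) ^+ w * Phi j i).
Proof. by rewrite prev1E ord_pred_S psi_eo. Qed.
Lemma psi2_ee (j i : 'I_N) w :
  psi (prev2 ((cycL (2 * j), cycL (2 * i)), w)) = - ((-1) ^+ w * Phi j (prev_pair N i)).
Proof. by rewrite prev2E ord_pred_even //; apply: (psi_eo j (Ordinal (prev_pair_lt i))). Qed.
Lemma psi2_oe (j i : 'I_N) w :
  psi (prev2 ((cycL (2 * j).+1, cycL (2 * i)), w)) = (-1) ^+ w * Phi j (prev_pair N i).
Proof. by rewrite prev2E ord_pred_even //; apply: (psi_oo j (Ordinal (prev_pair_lt i))). Qed.
Lemma psi2_eo (j i : 'I_N) w :
  psi (prev2 ((cycL (2 * j), cycL (2 * i).+1), w)) = (-1) ^+ w * Phi j i.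
Proof. by rewrite prev2E ord_pred_S psi_ee. Qed.
Lemma psi2_oo (j i : 'I_N) w :
  psi (prev2 ((cycL (2 * j).+1, cycL (2 * i).+1), w)) = - ((-1) ^+ w * Phi j i).
Proof. by rewrite prev2E ord_pred_S psi_oe. Qed.

(** Inside a pair of columns the two signs cancel; between pairs the amplitude is
    differentiated. *)
Lemma flow_dir1 M : \sum_x (psi (prev1 x) + psi x) * occ M [set prev1 x; x] =
  \sum_(i < N) \sum_(q : Q) (-1) ^+ q.2 * dif1 q.1 i *
    (occ M (edge1L (cycL (2 * i)) q) - occ M (edge1L (cycL (2 * i).+1) q)).
Proof.
rewrite sum_vertices exchange_big; apply: eq_bigr => i _.
rewrite -(pair_bigA _ (fun (j : 'I_N) w => (-1) ^+ nat_of_ord w * dif1 j i *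
    (occ M (edge1L (cycL (2 * i)) (j, w)) - occ M (edge1L (cycL (2 * i).+1) (j, w))))) /dif1.
apply: eq_bigr => j _; apply: eq_bigr => w _.
rewrite psi1_ee psi1_eo psi1_oe psi1_oo psi_ee psi_eo psi_oe psi_oo.
have -> : occ M (edge1L (cycL (2 * i)) (j, w)) = occ M [set prev1 ((cycL (2 * j), cycL (2 * i)), w);
   ((cycL (2 * j), cycL (2 * i)), w)] by [].
have -> : occ M (edge1L (cycL (2 * i).+1) (j, w)) = occ M [set prev1 ((cycL (2 * j), cycL (2 * i).+1), w);
   ((cycL (2 * j), cycL (2 * i).+1), w)] by [].
ring.
Qed.

Lemma flow_dir2 M : \sum_x (psi (prev2 x) + psi x) * occ M [set prev2 x; x] =
  \sum_(j < N) \sum_(q : Q) (-1) ^+ q.2 * dif2 j q.1 *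
    (occ M (edge2L (cycL (2 * j)) q) - occ M (edge2L (cycL (2 * j).+1) q)).
Proof.
rewrite sum_vertices; apply: eq_bigr => j _.
rewrite -(pair_bigA _ (fun (i : 'I_N) w => (-1) ^+ nat_of_ord w * dif2 j i *
    (occ M (edge2L (cycL (2 * j)) (i, w)) - occ M (edge2L (cycL (2 * j).+1) (i, w))))) /dif2.
apply: eq_bigr => i _; apply: eq_bigr => w _.
rewrite psi2_ee psi2_eo psi2_oe psi2_oo psi_ee psi_eo psi_oe psi_oo.
have -> : occ M (edge2L (cycL (2 * j)) (i, w)) = occ M [set prev2 ((cycL (2 * j), cycL (2 * i)), w);
   ((cycL (2 * j), cycL (2 * i)), w)] by [].
have -> : occ M (edge2L (cycL (2 * j).+1) (i, w)) = occ M [set prev2 ((cycL (2 * j).+1, cycL (2 * i)), w);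
   ((cycL (2 * j).+1, cycL (2 * i)), w)] by [].
ring.
Qed.

Variable z0 : 'I_N.
Hypothesis z0E : z0 = 0%N :> nat.

(** The staggered flow through the plane between the last slice and slice [0]. *)
Definition flux M : R := \sum_(i < N) \sum_w (-1) ^+ nat_of_ord w * Phi 0 i *
  (occ M (edge1L (cycL (2 * i)) (z0, w)) - occ M (edge1L (cycL (2 * i).+1) (z0, w))).

Definition energy1 := \sum_(j < N | j != z0) \sum_(i < N) (dif1 j i) ^+ 2.
Definition energy2 := \sum_(j < N) \sum_(i < N) (dif2 j i) ^+ 2.

(** The conservation law expresses the flux by two sums that [torus_variance] controls;
    the amplitude vanishes on the last slices, so the plane is crossed by [Phi 0] alone. *)
Lemma flux_moment m : (2 * m <= N)%N -> (forall j i, (m <= j)%N || (m <= i)%N -> Phi j i = 0) ->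
  \sum_(M in PM) flux M ^+ 2 <= 6 * K%:R * (energy1 + energy2) * D.
Proof.
move=> hm Phi0.
have hN : (0 < N)%N by lia.
pose a1 (i : nat) (q : Q) : R := if q.1 == z0 then 0 else (-1) ^+ q.2 * dif1 q.1 i.
pose a2 (j : nat) (q : Q) : R := (-1) ^+ q.2 * dif2 j q.1.
pose S1 M := \sum_(i < N) \sum_(q : Q) a1 i q * (occ M (edge1L (cycL (2 * i)) q) - occ M (edge1L (cycL (2 * i).+1) q)).
pose S2 M := \sum_(j < N) \sum_(q : Q) a2 j q * (occ M (edge2L (cycL (2 * j)) q) - occ M (edge2L (cycL (2 * j).+1) q)).
have a10 i q : (m <= i)%N -> a1 i q = 0.
  by move=> hi; rewrite /a1 /dif1 !Phi0 ?hi ?orbT // subrr mulr0 if_same.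
have a20 j q : (m <= j)%N -> a2 j q = 0.
  by move=> hi; rewrite /a2 /dif2 !Phi0 ?hi // subrr mulr0.
have V1 : \sum_(M in PM) S1 M ^+ 2 <= 3 * (\sum_(i < N) \sum_q a1 i q ^+ 2) * D.
  exact: (torus_variance LN (split2_bij L K) (@split2_iso L K L3) (@split2_edge L K N L3) hm a10).
have V2 : \sum_(M in PM) S2 M ^+ 2 <= 3 * (\sum_(i < N) \sum_q a2 i q ^+ 2) * D.
  exact: (torus_variance LN (split1_bij L K) (@split1_iso L K L3) (@split1_edge L K N L3) hm a20).
have sq (w : 'I_K) : ((-1) ^+ w) ^+ 2 = 1 :> R by rewrite sqrr_sign.
have W1 : \sum_(i < N) \sum_q a1 i q ^+ 2 = K%:R * energy1.
  rewrite /energy1 mulr_sumr exchange_big /=.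
  rewrite -(pair_bigA _ (fun (j : 'I_N) (w : 'I_K) => \sum_(i < N) a1 i (j, w) ^+ 2)) /=.
  rewrite [RHS]big_mkcond; apply: eq_bigr => j _; rewrite /a1 /=; case: eqP => _ /=.
    by rewrite big1 // => w _; rewrite big1 // => i _; rewrite expr0n.
  rewrite (eq_bigr (fun _ => \sum_(i < N) (dif1 j i) ^+ 2)); last first.
    by move=> w _; apply: eq_bigr => i _; rewrite exprMn sq mul1r.
  by rewrite sumr_const card_ord mulr_natl.
have W2 : \sum_(i < N) \sum_q a2 i q ^+ 2 = K%:R * energy2.
  rewrite /energy2 mulr_sumr; apply: eq_bigr => j _; rewrite mulr_sumr.
  rewrite -(pair_bigA _ (fun (i : 'I_N) (w : 'I_K) => a2 j (i, w) ^+ 2)) /=.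
  apply: eq_bigr => i _; rewrite /a2 /=.
  rewrite (eq_bigr (fun _ => (dif2 j i) ^+ 2)); last first.
    by move=> w _; rewrite exprMn sq mul1r.
  by rewrite sumr_const card_ord mulr_natl.
have key M : M \in PM -> flux M = - (S1 M + S2 M).
  move=> hM; have := flow_conservation hM; rewrite flow_dir1 flow_dir2 -/(S2 M).
  suff -> : \sum_(i < N) \sum_(q : Q) (-1) ^+ q.2 * dif1 q.1 i *
    (occ M (edge1L (cycL (2 * i)) q) - occ M (edge1L (cycL (2 * i).+1) q)) = flux M + S1 M.
    by move=> h; apply/eqP; rewrite -addr_eq0 addrA h.
  rewrite /flux /S1 -big_split /=; apply: eq_bigr => i _.
  rewrite -(pair_bigA _ (fun (j : 'I_N) w => (-1) ^+ nat_of_ord w * dif1 j i *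
    (occ M (edge1L (cycL (2 * i)) (j, w)) - occ M (edge1L (cycL (2 * i).+1) (j, w))))) /=.
  rewrite -(pair_bigA _ (fun (j : 'I_N) w => a1 i (j, w) *
    (occ M (edge1L (cycL (2 * i)) (j, w)) - occ M (edge1L (cycL (2 * i).+1) (j, w))))) /=.
  rewrite (bigD1 z0) //= [X in _ = _ + X](bigD1 z0) //=.
  rewrite [X in _ = _ + (X + _)]big1 ?add0r; last first.
    by move=> w _; rewrite /a1 eqxx mul0r.
  congr (_ + _).
    apply: eq_bigr => w _; rewrite /dif1 z0E /= [Phi N.-1 _]Phi0 ?subr0 //.
    by apply/orP; left; lia.
  by apply: eq_bigr => j nj; apply: eq_bigr => w _; rewrite /a1 /= (negbTE nj).
apply: (@le_trans _ _ (2 * \sum_(M in PM) S1 M ^+ 2 + 2 * \sum_(M in PM) S2 M ^+ 2)).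
  rewrite !mulr_sumr -big_split /=; apply: ler_sum => M hM; rewrite key //.
  rewrite -subr_ge0; have -> : 2 * S1 M ^+ 2 + 2 * S2 M ^+ 2 - (- (S1 M + S2 M)) ^+ 2 = (S1 M - S2 M) ^+ 2 by ring.
  exact: sqr_ge0.
rewrite W1 in V1; rewrite W2 in V2.
have -> : 6 * K%:R * (energy1 + energy2) * D = 2 * (3 * (K%:R * energy1) * D) + 2 * (3 * (K%:R * energy2) * D) by ring.
by apply: lerD; rewrite ler_pM2l.
Qed.

End Ward.

Lemma sum_indicator_le (R : realFieldType) n (P : nat -> bool) a b : (forall i, P i -> (a <= i < b)%N) ->
  \sum_(i < n) (P i)%:R <= (b - a)%N%:R :> R.
Proof.
move=> h; rewrite -natr_sum ler_nat; apply: (@leq_trans (\sum_(i < n) (a <= i < b))).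
  by apply: leq_sum => i _; case Pi: (P i) => //; rewrite h.
by rewrite count_window; lia.
Qed.

(** * The logarithmic cone and its energy *)

Section Harmonic.
Variables (R : realFieldType) (r : nat).
Hypothesis r0 : (0 < r)%N.

Definition harm : R := \sum_(k < r) k.+1%:R^-1.

Lemma harm_gt0 : 0 < harm.
Proof.
rewrite /harm; case: (r) r0 => // n _; rewrite big_ord_recl invr1.
by apply: ltr_wpDr => //; apply: sumr_ge0 => k _; rewrite invr_ge0 ler0n.
Qed.

(** Decreases from 1 to 0 over the distance [r], with increments proportional to
    1 / s: the discrete form of 1 - ln s / ln r. *)
Definition profile (s : nat) : R := (\sum_(s <= k < r) k.+1%:R^-1) / harm.
Definition drop_at s : R := profile s - profile s.+1.

Lemma profile0 : profile 0 = 1.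
Proof. by rewrite /profile big_mkord -/harm divff // gt_eqF ?harm_gt0. Qed.

Lemma profile_out s : (r <= s)%N -> profile s = 0.
Proof. by move=> h; rewrite /profile big_geq // mul0r. Qed.

Lemma profile_ge0 s : 0 <= profile s.
Proof.
apply: divr_ge0; last exact: ltW harm_gt0.
by apply: sumr_ge0 => k _; rewrite invr_ge0 ler0n.
Qed.

Lemma drop_atE s : drop_at s = if (s < r)%N then s.+1%:R^-1 / harm else 0.
Proof.
rewrite /drop_at; case: ltnP => h; last by rewrite !profile_out ?subrr //; apply: leq_trans h _.
by rewrite /profile (big_ltn h) mulrDl addrK.
Qed.

(** There are of order s sites at distance s, so the energy at this distance is the
    increment itself over [harm], and the total telescopes. *)
Lemma drop_at_sq s : s.+1%:R * drop_at s ^+ 2 = drop_at s / harm.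
Proof.
rewrite drop_atE; case: ifP => _; last by rewrite expr0n /= mulr0 mul0r.
have : s.+1%:R != 0 :> R by rewrite pnatr_eq0.
move: (s.+1%:R) => x hx; field.
by rewrite hx gt_eqF // harm_gt0.
Qed.

Lemma sum_drop_at n : \sum_(s < n) drop_at s <= 1.
Proof.
suff -> : \sum_(s < n) drop_at s = 1 - profile n by rewrite lerBlDr lerDl profile_ge0.
elim: n => [|n IH]; first by rewrite big_ord0 profile0 subrr.
by rewrite big_ord_recr /= IH /drop_at; ring.
Qed.

Definition offset (i : nat) := ((i - r) + (r - i))%N.
Definition cone (j i : nat) : R := profile (maxn j (offset i)).

Lemma cone_out j i : (2 * r <= j)%N || (2 * r <= i)%N -> cone j i = 0.
Proof. by move=> h; rewrite /cone profile_out // /offset; lia. Qed.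

Lemma profile_step j s : profile (maxn j s.+1) - profile (maxn j s) = if (j <= s)%N then - drop_at s else 0.
Proof.
case: ifP => h; last by rewrite (_ : maxn j s.+1 = maxn j s) ?subrr //; lia.
have -> : maxn j s.+1 = s.+1 by lia.
have -> : maxn j s = s by lia.
by rewrite /drop_at opprB.
Qed.

Variable N : nat.
Hypothesis rN : (4 * r <= N)%N.

(** The increment in the first direction lives on the [2 * j + 1] columns at distance at
    most [j] from the axis. *)
Lemma cone_col j : \sum_(i < N) (cone j.+1 i - cone j i) ^+ 2 <= 2 * (drop_at j / harm).
Proof.
have E (i : 'I_N) : (cone j.+1 i - cone j i) ^+ 2 = drop_at j ^+ 2 * (offset i <= j)%:R.
  rewrite /cone ![maxn _ (offset i)]maxnC profile_step; case: ifP => _; first by rewrite sqrrN mulr1.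
  by rewrite expr0n mulr0.
rewrite (eq_bigr _ (fun i _ => E i)) -mulr_sumr.
have h : \sum_(i < N) (offset i <= j)%:R <= 2 * j.+1%:R :> R.
  have hP i : (offset i <= j)%N -> (r - j <= i < (r + j).+1)%N by rewrite /offset; lia.
  apply: (le_trans (sum_indicator_le R N hP)).
  by rewrite -natrM ler_nat; lia.
apply: (le_trans (ler_wpM2l (sqr_ge0 _) h)).
by rewrite mulrCA [_ ^+ 2 * _]mulrC drop_at_sq.
Qed.

(** The smaller of the distances of [i] and [i.+1] to the axis [r] of the cone. *)
Definition row_level i := (if (r <= i) then i - r else r - i.+1)%N.

(** The increment in the second direction lives on the rows up to the level. *)
Lemma cone_row i : \sum_(j < N) (cone j i.+1 - cone j i) ^+ 2 <= drop_at (row_level i) / harm.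
Proof.
have E (j : 'I_N) : (cone j i.+1 - cone j i) ^+ 2 = drop_at (row_level i) ^+ 2 * (j <= row_level i)%:R.
  rewrite /cone /row_level /offset; case: leqP => hi.
    have -> : (i.+1 - r + (r - i.+1) = (i - r).+1)%N by lia.
    have -> : (i - r + (r - i) = i - r)%N by lia.
    by rewrite profile_step; case: ifP => _; rewrite ?sqrrN ?mulr1 ?mulr0 ?expr0n.
  have -> : (i.+1 - r + (r - i.+1) = r - i.+1)%N by lia.
  have -> : (i - r + (r - i) = (r - i.+1).+1)%N by lia.
  by rewrite -sqrrN opprB profile_step; case: ifP => _; rewrite ?sqrrN ?mulr1 ?mulr0 ?expr0n.
rewrite (eq_bigr _ (fun i _ => E i)) -mulr_sumr.
have h : \sum_(j < N) (j <= row_level i)%:R <= (row_level i).+1%:R :> R.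
  have hP j : (j <= row_level i)%N -> (0 <= j < (row_level i).+1)%N by lia.
  by apply: (le_trans (sum_indicator_le R N hP)); rewrite subn0.
by apply: (le_trans (ler_wpM2l (sqr_ge0 _) h)); rewrite mulrC drop_at_sq.
Qed.

(** Every level occurs on both sides of the axis. *)
Lemma sum_row_level n : (r <= n)%N -> \sum_(i < n) drop_at (row_level i) <= 2.
Proof.
move=> hn; rewrite -(big_mkord xpredT (fun i => drop_at (row_level i))) (@big_cat_nat _ _ _ r) //=.
rewrite big_mkord -[r in X in _ + X]add0n big_addn big_mkord.
have -> : 2 = 1 + 1 :> R by [].
apply: lerD.
  rewrite (reindex_inj rev_ord_inj) /=; rewrite (eq_bigr (fun i : 'I_r => drop_at i)) ?sum_drop_at // => i _.
  by congr drop_at; rewrite /row_level /=; have := ltn_ord i; case: ifP; lia.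
rewrite (eq_bigr (fun i : 'I__ => drop_at i)) ?sum_drop_at // => i _.
by congr drop_at; rewrite /row_level; case: ifP; lia.
Qed.

Lemma sum_nonzero (G : nat -> R) n (z0 : 'I_n) : z0 = 0%N :> nat ->
  \sum_(j < n | j != z0) G j = \sum_(j < n.-1) G j.+1.
Proof.
case: n z0 => [[]//|n] z0 z0E; rewrite big_mkcond big_ord_recl /= -val_eqE /= z0E eqxx add0r.
by apply: eq_bigr => j _; rewrite -val_eqE /= z0E.
Qed.

Lemma cone_energy1 (z0 : 'I_N) : z0 = 0%N :> nat -> energy1 cone z0 <= 2 / harm.
Proof.
move=> z0E; have N0 : (0 < N)%N by lia.
have hh := harm_gt0.
apply: (@le_trans _ _ (\sum_(j < N.-1) 2 * (drop_at j / harm))); last first.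
  rewrite -mulr_sumr -mulr_suml ler_pM2l // -[leRHS]mul1r ler_pM2r ?invr_gt0 //.
  exact: sum_drop_at.
rewrite /energy1 (sum_nonzero (fun j => \sum_(i < N) (dif1 N cone j i) ^+ 2)) //.
by apply: ler_sum => j _; apply: cone_col.
Qed.

Lemma cone_energy2 : energy2 N cone <= 2 / harm.
Proof.
have N0 : (0 < N)%N by lia.
have hh := harm_gt0; pose z0 := Ordinal N0.
rewrite /energy2 exchange_big /= (bigD1 z0) //= [X in X + _]big1 ?add0r; last first.
  move=> j _; have c0 : cone j 0 = 0 by rewrite /cone profile_out // /offset; lia.
  have c1 : cone j N.-1 = 0 by rewrite cone_out //; lia.
  by rewrite /dif2 /= c0 c1 subrr expr0n.
rewrite (sum_nonzero (fun i => \sum_(j < N) (dif2 N cone j i) ^+ 2)) //.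
apply: (@le_trans _ _ (\sum_(i < N.-1) drop_at (row_level i) / harm)).
  by apply: ler_sum => i _; apply: cone_row.
by rewrite -mulr_suml ler_pM2r ?invr_gt0 // sum_row_level //; lia.
Qed.

End Harmonic.

(** * Two monomers in adjacent slices *)

Lemma sum_inj_le (R : realFieldType) (T : finType) (P : pred T) (h : T -> T) (f : T -> R) :
  (forall x, 0 <= f x) -> {in P &, injective h} -> \sum_(x | P x) f (h x) <= \sum_x f x.
Proof.
move=> f0 hi; have -> : \sum_(x | P x) f (h x) = \sum_(x in [set x | P x]) f (h x).
  by apply: eq_bigl => x; rewrite inE.
rewrite -(big_imset f (h := h)) /=; last by move=> x y; rewrite !inE; apply: hi.
by rewrite big_mkcond; apply: ler_sum => x _; case: ifP.
Qed.

Section Plane.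
Variables (R : realFieldType) (Y : finType) (g : rel Y).
Hypotheses (g_sym : symmetric g) (g_irr : irreflexive g).
Variables (N L : nat) (LN : (L = 2 * N)%N) (L3 : (2 < L)%N).
Notation mat := 'M[R]_#|{set Y}|.
Notation ch := (@chain Y g L).
Notation cycL := (cyc L3).
Notation T := (transfer R g setT).
Notation atL := (@at_slice Y L).
Notation cre := (create R).
Notation G := (T ^+ L).
Notation D := ((nmatch ch setT)%:R : R).
Notation W := (T ^+ N).

Lemma entryG S S' : entry G S S' = \sum_U entry W S U * entry W S' U.
Proof.
rewrite LN mulnC exprM expr2 entryM; apply: eq_bigr => U _.
by rewrite -[entry _ U S']entry_tr (exp_sym (transferT_sym _ _)).
Qed.

Lemma entryG_ge0 S : 0 <= entry G S S.
Proof. exact: (entry_TL_ge0 R g LN). Qed.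

Lemma sum_G : \sum_S entry G S S = D.
Proof. by rewrite -entry_trace (nmatch_full R g_sym g_irr L3). Qed.

(** Cauchy-Schwarz for the Gram matrix [G], in the weighted additive form. *)
Lemma entryG_amgm S S' a b lam : 0 < lam ->
  a * b * entry G S S' <= 2^-1 * (lam * a ^+ 2 * entry G S S + lam^-1 * b ^+ 2 * entry G S' S').
Proof.
move=> l0; rewrite !entryG !mulr_sumr -big_split /= mulr_sumr; apply: ler_sum => U _.
set x := entry _ S U; set y := entry _ S' U; rewrite -subr_ge0.
have -> : 2^-1 * (lam * a ^+ 2 * (x * x) + lam^-1 * b ^+ 2 * (y * y)) - a * b * (x * y) =
   2^-1 * lam * (a * x - lam^-1 * b * y) ^+ 2 by field; rewrite gt_eqF.
by rewrite mulr_ge0 ?sqr_ge0 // mulr_ge0 ?invr_ge0 // ltW.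
Qed.

Lemma tr_create_le X : \tr (cre X * G) <= D.
Proof.
rewrite entry_trace (eq_bigr (fun S : {set Y} => if [disjoint S & X] then entry G (S :|: X) S else 0)); last first.
  by move=> S _; rewrite create_mul.
rewrite -big_mkcond /=.
apply: (@le_trans _ _ (\sum_(S : {set Y} | [disjoint S & X]) 2^-1 * (entry G (S :|: X) (S :|: X) + entry G S S))).
  apply: ler_sum => S _; have := @entryG_amgm (S :|: X) S 1 1 1 ltr01.
  by rewrite invr1 !expr1n !mul1r.
rewrite -mulr_sumr big_split /=.
have h1 : \sum_(S : {set Y} | [disjoint S & X]) entry G (S :|: X) (S :|: X) <= D.
  rewrite -sum_G; apply: (@sum_inj_le _ _ _ (fun S : {set Y} => S :|: X) (fun S : {set Y} => entry G S S)).
    exact: entryG_ge0.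
  move=> S S'; rewrite -!topredE /= => /setDidPl d /setDidPl d' E.
  by rewrite -d -d'; move/(congr1 (fun Z => Z :\: X)): E; rewrite !setDUl setDv !setU0.
have h2 : \sum_(S : {set Y} | [disjoint S & X]) entry G S S <= D.
  by rewrite -sum_G; apply: (@sum_inj_le _ _ _ id (fun S : {set Y} => entry G S S)); [exact: entryG_ge0|move=> S S'].
lra.
Qed.

(** Removing the same set [X = X'] on both sides of a plane prescribes the edges that
    cross it there; removing different sets puts monomers on its two sides. *)
Lemma nmatch_adjacent t X X' : (nmatch ch (~: (atL t X :|: atL (cycL (t + 1)) X')))%:R =
  \tr ((cre X)^T * cre X' * G).
Proof.
rewrite (nmatch_two_slices R g_sym g_irr) /=; last by lia.
rewrite expr0 mulr1 -(T_createT R g) -(create_T R g) -!mulrA tr_C -!mulrA -exprSr -exprS.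
by rewrite (_ : (L - 2).+2 = L) //; lia.
Qed.

Lemma cyc_last : cycL (cycL L.-1 + 1) = cycL 0.
Proof.
apply: val_inj; rewrite /= modnDml mod0n (_ : L.-1 + 1 = L)%N ?modnn //; lia.
Qed.

Definition hop y y' (S : {set Y}) := y' |: S :\ y.

Lemma tr_pair y y' : \tr ((cre [set y])^T * cre [set y'] * G) =
  \sum_(S : {set Y} | (y \in S) && (y' \notin S :\ y)) entry G (hop y y' S) S.
Proof.
rewrite entry_trace [RHS]big_mkcond /=; apply: eq_bigr => S _.
rewrite -mulrA createT_mul create_mul sub1set; case: (y \in S) => //=.
by rewrite disjoint_sym disjoints1 setUC.
Qed.

Lemma hop_inj y y' : {in [pred S : {set Y} | (y \in S) && (y' \notin S :\ y)] &, injective (hop y y')}.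
Proof.
have K (S : {set Y}) : (y \in S) && (y' \notin S :\ y) -> S = y |: (hop y y' S :\ y').
  by move=> /andP[h1 h2]; rewrite /hop setU1K // setD1K.
by move=> S S' hS hS' E; rewrite (K S hS) (K S' hS') E.
Qed.

Lemma tr_pair_le y y' : \tr ((cre [set y])^T * cre [set y'] * G) <= D.
Proof.
rewrite tr_pair.
apply: (@le_trans _ _ (\sum_(S : {set Y} | (y \in S) && (y' \notin S :\ y))
    2^-1 * (entry G (hop y y' S) (hop y y' S) + entry G S S))).
  apply: ler_sum => S _; have := @entryG_amgm (hop y y' S) S 1 1 1 ltr01.
  by rewrite invr1 !expr1n !mul1r.
rewrite -mulr_sumr big_split /=.
have h1 : \sum_(S : {set Y} | (y \in S) && (y' \notin S :\ y)) entry G (hop y y' S) (hop y y' S) <= D.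
  rewrite -sum_G; apply: (@sum_inj_le _ _ _ (hop y y') (fun S : {set Y} => entry G S S)).
    exact: entryG_ge0.
  exact: hop_inj.
have h2 : \sum_(S : {set Y} | (y \in S) && (y' \notin S :\ y)) entry G S S <= D.
  by rewrite -sum_G; apply: (@sum_inj_le _ _ _ id (fun S : {set Y} => entry G S S)); [exact: entryG_ge0|move=> S S'].
lra.
Qed.

Variable s : Y -> R.
Definition slice_total (S : {set Y}) : R := \sum_(y in S) s y.
Definition moment : R := \sum_S entry G S S * slice_total S ^+ 2.

(** [slice_total] changes by [d = s y' - s y] under [hop], and [d ^+ 2 = 1]; writing each
    entry of [G] as [d ^+ 2] times itself, [d] is split into the two totals, to which
    [entryG_amgm] applies. *)
Lemma tr_pair_moment y y' lam : 0 < lam -> y != y' -> `|s y' - s y| = 1 ->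
  \tr ((cre [set y])^T * cre [set y'] * G) <= lam * moment + lam^-1 * D.
Proof.
move=> l0 ny hs; rewrite tr_pair.
pose P := [pred S : {set Y} | (y \in S) && (y' \notin S :\ y)].
pose U := hop y y'.
have chgU S : P S -> slice_total (U S) - slice_total S = s y' - s y.
  move=> /andP[yS y'S]; rewrite /slice_total /U /hop (big_setU1 _ y'S) /= (big_setD1 _ yS) /=; ring.
have one S : P S -> entry G (U S) S <=
   2^-1 * (lam * (entry G (U S) (U S) * slice_total (U S) ^+ 2) + lam^-1 * entry G S S) +
   2^-1 * (lam * (entry G S S * slice_total S ^+ 2) + lam^-1 * entry G (U S) (U S)).
  move=> /chgU; set d := s y' - s y => hd.
  have d2 : d ^+ 2 = 1 by rewrite -real_normK ?num_real // hs expr1n.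
  have h1 := @entryG_amgm (U S) S (slice_total (U S)) d lam l0.
  have h2 := @entryG_amgm S (U S) (slice_total S) (- d) lam l0.
  have C : entry G S (U S) = entry G (U S) S.
    by rewrite !entryG; apply: eq_bigr => Z _; rewrite mulrC.
  rewrite C in h2.
  have -> : entry G (U S) S = (slice_total (U S) * d * entry G (U S) S) + (slice_total S * - d * entry G (U S) S).
    by rewrite -mulrDl mulrN -mulrBl hd -expr2 d2 mul1r.
  rewrite sqrrN in h2; rewrite d2 mulr1 in h1 h2.
  apply: lerD.
    apply: le_trans h1 _; rewrite le_eqVlt; apply/orP; left; apply/eqP; ring.
  apply: le_trans h2 _; rewrite le_eqVlt; apply/orP; left; apply/eqP; ring.
apply: (le_trans (ler_sum _ one)).
rewrite big_split /= -!mulr_sumr !big_split /= -!mulr_sumr.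
have f1 (f : {set Y} -> R) : (forall S, 0 <= f S) -> \sum_(S | P S) f (U S) <= \sum_S f S.
  by move=> f0; apply: (sum_inj_le f0); apply: hop_inj.
have f2 (f : {set Y} -> R) : (forall S, 0 <= f S) -> \sum_(S | P S) f S <= \sum_S f S.
  by move=> f0; apply: (sum_inj_le (h := id) f0) => S S'.
have p1 S : 0 <= entry G S S * slice_total S ^+ 2 by rewrite mulr_ge0 ?sqr_ge0 ?entryG_ge0.
have a1 := ler_wpM2l (ltW l0) (f1 _ p1).
have a2 := ler_wpM2l (ltW l0) (f2 _ p1).
have li : 0 <= lam^-1 by rewrite invr_ge0 ltW.
have b1 := ler_wpM2l li (f1 _ entryG_ge0).
have b2 := ler_wpM2l li (f2 _ entryG_ge0).
rewrite sum_G in b1 b2; rewrite -/moment in a1 a2.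
rewrite /P /= in a1 a2 b1 b2 *.
lra.
Qed.

Definition link y : {set 'I_L * Y} := [set (cycL L.-1, y); (cycL 0, y)].

Lemma link_edge y : link y \in edge_set ch.
Proof.
apply/edge_setP; exists (cycL L.-1, y), (cycL 0, y); split=> //.
rewrite /chain /= eqxx andbT; apply/orP; right; rewrite cyc_adjE // ordS_cyc //.
by apply/orP; left; rewrite -cyc_last; apply/eqP; apply: val_inj; rewrite /= modnDml addn1.
Qed.

Lemma nmatch2_link y y' : (nmatch2 ch (link y) (link y'))%:R =
  \sum_(S : {set Y}) ((y \in S) && (y' \in S))%:R * entry G S S.
Proof.
pose X := [set y; y'].
have -> : nmatch2 ch (link y) (link y') = nmatch ch (~: (atL (cycL L.-1) X :|: atL (cycL (cycL L.-1 + 1)) X)).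
  have EX : atL (cycL L.-1) X :|: atL (cycL (cycL L.-1 + 1)) X = link y :|: link y'.
    rewrite cyc_last; apply/setP => -[t z]; rewrite !inE !in_at_slice !inE !xpair_eqE.
    by case: (t == _); case: (t == _); case: (z == y); case: (z == y').
  rewrite EX nmatch2E ?link_edge //; case: (altP (y =P y')) => [->|ny]; first by rewrite eqxx setUid.
  have d : [disjoint link y & link y'].
    rewrite -setI_eq0; apply/eqP/setP => -[t z]; rewrite !inE !xpair_eqE.
    case: (z =P y) => [->|]; rewrite ?andbF //= (negbTE ny) !andbF //.
  rewrite d ifN //; apply: contraTneq d => ->; rewrite -setI_eq0 setIid.
  by apply/set0Pn; exists (cycL 0, y'); rewrite !inE eqxx orbT.
rewrite nmatch_adjacent entry_trace; apply: eq_bigr => S _.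
rewrite createT_create entryM (bigD1 S) //= big1 ?addr0.
  by rewrite entry_setmx eqxx andbT subUset !sub1set.
by move=> U nU; rewrite entry_setmx eq_sym (negbTE nU) andbF mul0r.
Qed.

(** [moment] is the second moment of the weighted number of edges crossing a plane. *)
Lemma link_moment :
  \sum_(M in matchings ch setT) (\sum_y s y * (link y \in M)%:R) ^+ 2 = moment.
Proof.
rewrite second_moment /moment.
transitivity (\sum_y \sum_y' \sum_(S : {set Y}) s y * s y' * (((y \in S) && (y' \in S))%:R * entry G S S)).
  by apply: eq_bigr => y _; apply: eq_bigr => y' _; rewrite nmatch2_link mulr_sumr.
rewrite (eq_bigr (fun y => \sum_(S : {set Y}) \sum_y' s y * s y' * (((y \in S) && (y' \in S))%:R * entry G S S))).
  rewrite exchange_big; apply: eq_bigr => S _ /=.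
  have -> : slice_total S = \sum_y s y * (y \in S)%:R.
    by rewrite /slice_total big_mkcond; apply: eq_bigr => y _; case: ifP; rewrite ?mulr1 ?mulr0.
  rewrite expr2 mulr_suml mulr_sumr; apply: eq_bigr => y _.
  rewrite !mulr_sumr; apply: eq_bigr => y' _.
  by rewrite -mulnb natrM; ring.
by move=> y _; rewrite exchange_big.
Qed.

End Plane.

(** * Reduction to adjacent slices *)

Section Averaging.
Variables (R : realFieldType) (Y : finType) (g : rel Y).
Hypotheses (g_sym : symmetric g) (g_irr : irreflexive g).
Variables (N L : nat) (LN : (L = 2 * N)%N) (L3 : (2 < L)%N).
Notation mat := 'M[R]_#|{set Y}|.
Notation ch := (@chain Y g L).
Notation cycL := (cyc L3).
Notation T := (transfer R g setT).
Notation D := ((nmatch ch setT)%:R : R).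
Notation F x x' := ((nmatch ch (~: [set x; x']))%:R : R).

Lemma pair_set (t : 'I_L) y (t' : 'I_L) y' :
  [set (t, y); (t', y')] = @at_slice Y L t [set y] :|: at_slice t' [set y'].
Proof. by rewrite /at_slice !imset_set1. Qed.

Definition one_out : mat := \sum_y transfer R g (~: [set y]).

Lemma one_out_sym : one_out^T = one_out.
Proof. by rewrite /one_out raddf_sum; apply: eq_bigr => y _; apply: transfer_sym. Qed.

(** For [0 < n < L], the number of matchings with two monomers in slices at distance
    [n], summed over their positions in the slices ([sum_pair_corr]). *)
Definition pair_corr n : R := loop T n.-1 (L - n.+1) one_out one_out.

Lemma sum_pair_corr (t : 'I_L) d : (0 < d < L)%N ->
  \sum_y \sum_y' F (t, y) (cycL (t + d), y') = pair_corr d.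
Proof.
move=> hd; rewrite /pair_corr /loop one_out_sym {1}/one_out !mulr_suml raddf_sum /=.
apply: eq_bigr => y _; rewrite /one_out mulr_sumr mulr_suml raddf_sum /=.
by apply: eq_bigr => y' _; rewrite pair_set (nmatch_two_slices R g_sym g_irr).
Qed.

Lemma pair_corr_sub n : (0 < n < L)%N -> pair_corr (L - n) = pair_corr n.
Proof.
move=> hn; rewrite /pair_corr /loop one_out_sym -mulrA tr_C mulrA.
rewrite (_ : (L - n).-1 = L - n.+1)%N; last by lia.
by rewrite (_ : L - (L - n).+1 = n.-1)%N //; lia.
Qed.

(** Cutting the cycle of slices into two halves just after the first monomer separates
    the two monomers; doubling one half by reflection puts them at distance 1, doubling the
    other one at distance [2 * n - 1]. *)
Lemma pair_corr_midpoint n : (0 < n <= N)%N -> 2 * pair_corr n <= pair_corr 1 + pair_corr (2 * n).-1.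
Proof.
move=> hn; pose P := T ^+ 0 * one_out * T ^+ N.-1.
pose Q := T ^+ n.-1 * one_out * T ^+ (N - n).
have := frob_ge0 (P - Q); rewrite !frobBl !frobBr [frob Q P]frobC /P /Q !(frob_loop (transferT_sym R g)).
rewrite /pair_corr.
rewrite (_ : (N.-1 + N.-1 = L - 2)%N); last by lia.
rewrite (_ : (0 + n.-1 = n.-1)%N); last by lia.
rewrite (_ : (N.-1 + (N - n) = L - n.+1)%N); last by lia.
rewrite (_ : (n.-1 + n.-1 = (2 * n).-1.-1)%N); last by lia.
rewrite (_ : (N - n + (N - n) = L - (2 * n).-1.+1)%N); last by lia.
rewrite add0n /=; lra.
Qed.

(** At a maximum [n <= N], midpoint convexity between 1 and [2 * n - 1] leaves no room
    above the value at 1. *)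
Lemma pair_corr_max n : (0 < n < L)%N -> pair_corr n <= pair_corr 1.
Proof.
move=> hn; have L1 : (0 < L.-1)%N by lia.
case: (arg_maxP (P := xpredT) (i0 := Ordinal L1) (fun i : 'I_L.-1 => pair_corr i.+1) erefl) => i _ hi.
have hmax k : (0 < k < L)%N -> pair_corr k <= pair_corr i.+1.
  move=> hk; have hk' : (k.-1 < L.-1)%N by lia.
  by have := hi (Ordinal hk') erefl; rewrite /= prednK //; lia.
apply: (le_trans (hmax n hn)).
have small k : (0 < k <= N)%N -> pair_corr k = pair_corr i.+1 -> pair_corr i.+1 <= pair_corr 1.
  move=> hk E; have := pair_corr_midpoint hk; have : pair_corr (2 * k).-1 <= pair_corr i.+1 by apply: hmax; lia.
  rewrite E; lra.
have hiL := ltn_ord i.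
case: (leqP i.+1 N) => h; first by apply: (small i.+1).
by apply: (small (L - i.+1)%N); rewrite ?pair_corr_sub //; lia.
Qed.

Hypothesis htrans : forall y1 y2 : Y, exists s : Y -> Y,
  [/\ bijective s, forall x y, g (s x) (s y) = g x y & s y1 = y2].

Lemma sum_slice_indep (t t' : 'I_L) y1 y2 : \sum_y' F (t, y1) (t', y') = \sum_y' F (t, y2) (t', y').
Proof.
have [s [bs gs <-]] := htrans y1 y2; have is_ := bij_inj bs.
rewrite [RHS](reindex s) /=; last exact: onW_bij.
apply: eq_bigr => y' _; congr (_%:R).
pose h (x : 'I_L * Y) := (x.1, s x.2).
have bh : bijective h by have [k sk ks] := bs; exists (fun x => (x.1, k x.2)) => -[a b]; rewrite /h /= ?sk ?ks.
have hE x y : ch (h x) (h y) = ch x y by rewrite /chain /h /= gs (inj_eq is_).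
have cs : symmetric ch by exact: chain_sym.
have ci : irreflexive ch by apply: chain_irr.
rewrite -(nmatch_iso cs ci cs ci bh hE); congr nmatch; apply/setP => z; have [k hk kh] := bh.
rewrite -[(t, s y1)]/(h (t, y1)) -[(t', s y')]/(h (t', y')).
by rewrite -(kh z) (mem_imset _ _ (bij_inj bh)) !inE !(inj_eq (bij_inj bh)).
Qed.

Lemma same_slice_le (t : 'I_L) y y' : F (t, y) (t, y') <= D.
Proof.
rewrite pair_set /at_slice -imsetU -/(at_slice t _) (nmatch_one_slice R g_sym g_irr L3).
apply: (tr_create_le R g_sym g_irr LN L3).
Qed.

Lemma adjacent_slice_le y y' : F (cycL L.-1, y) (cycL 0, y') <= D.
Proof.
rewrite -(cyc_last LN) pair_set (nmatch_adjacent R g_sym g_irr LN L3).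
apply: (tr_pair_le R g_sym g_irr LN L3).
Qed.

(** Slices other than the one of the first monomer contribute at most the adjacent
    pair; transitivity on the slice fixes one monomer of that pair. *)
Lemma averaging (t0 : 'I_L) y1 y0 : \sum_x F (t0, y1) x <=
  #|Y|%:R * D + L%:R * \sum_y' F (cycL L.-1, y0) (cycL 0, y').
Proof.
pose S0 := \sum_y' F (cycL L.-1, y0) (cycL 0, y'); rewrite -/S0.
have Y0 : 0 < #|Y|%:R :> R by rewrite ltr0n; apply/card_gt0P; exists y1.
have S00 : 0 <= S0 by apply: sumr_ge0 => y _; rewrite ler0n.
rewrite -(ler_pM2l Y0).
have E : \sum_x F (t0, y1) x = \sum_t' \sum_y' F (t0, y1) (t', y').
  by rewrite pair_bigA; apply: eq_bigr => -[].
have -> : #|Y|%:R * \sum_x F (t0, y1) x = \sum_t' \sum_y \sum_y' F (t0, y) (t', y').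
  rewrite E mulr_sumr; apply: eq_bigr => t' _.
  by rewrite (eq_bigr _ (fun y _ => sum_slice_indep t0 t' y y1)) sumr_const mulr_natl.
have aa1 : pair_corr 1 = #|Y|%:R * S0.
  rewrite -(sum_pair_corr (cycL L.-1)); last by lia.
  rewrite (cyc_last LN) (eq_bigr _ (fun y _ => sum_slice_indep _ _ y y0)) sumr_const. by rewrite -/S0 mulr_natl.
have bnd t' : \sum_y \sum_y' F (t0, y) (t', y') <=
    (if t' == t0 then #|Y|%:R * (#|Y|%:R * D) else 0) + #|Y|%:R * S0.
  case: eqP => [->|/eqP nt].
    apply: ler_wpDr; first by rewrite mulr_ge0 // ltW.
    have h y : \sum_y' F (t0, y) (t0, y') <= #|Y|%:R * D.
      by rewrite mulr_natl -sumr_const; apply: ler_sum => y' _; apply: same_slice_le.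
    by rewrite mulr_natl -sumr_const; apply: ler_sum => y _; apply: h.
  rewrite add0r -aa1; pose d := (if t0 < t' then t' - t0 else t' + L - t0)%N.
  have h1 := ltn_ord t0; have h2 := ltn_ord t'.
  have nt' : t' != t0 :> nat by [].
  have hd : (0 < d < L)%N by rewrite /d; case: (ltnP t0 t') => h; lia.
  have -> : t' = cycL (t0 + d).
    apply: val_inj; rewrite /= /d; case: (ltnP t0 t') => h.
      by rewrite subnKC ?modn_small // ltnW.
    by rewrite subnKC ?modnDr ?modn_small //; lia.
  by rewrite sum_pair_corr // pair_corr_max.
apply: (le_trans (ler_sum _ (fun t' _ => bnd t'))).
rewrite big_split /= -big_mkcond /= big_pred1_eq sumr_const card_ord -[X in _ + X]mulr_natl mulrDr lerD2l.
by rewrite mulrCA.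
Qed.

End Averaging.

(** * The bound on the slab torus *)

Lemma cycle_trans n (a b : 'I_n) : exists f : 'I_n -> 'I_n,
  [/\ bijective f, forall x y, cyc_adj (f x) (f y) = cyc_adj x y & f a = b].
Proof.
exists (iter (b + n - a) (@ordS n)); split.
- apply: injF_bij; elim: (b + n - a)%N => [|k IH] x y //=.
  by move/(can_inj (@ordSK n))/IH.
- by move=> x y; elim: (b + n - a)%N => [|k IH] //=; rewrite cyc_adj_S.
- have E k : iter k (@ordS n) a = ((a + k) %% n)%N :> nat.
    elim: k => [|k IH]; first by rewrite addn0 modn_small.
    by rewrite /= IH -addn1 modnDml addn1 addnS.
  apply: val_inj; rewrite /= E; have := ltn_ord a; have := ltn_ord b => hb ha.
  by rewrite subnKC ?modnDr ?modn_small //; lia.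
Qed.

Lemma slice_trans L K (y1 y2 : 'I_L * 'I_K) : exists s : 'I_L * 'I_K -> 'I_L * 'I_K,
  [/\ bijective s, forall x y, slice_rel (s x) (s y) = slice_rel x y & s y1 = y2].
Proof.
case: y1 y2 => [a1 b1] [a2 b2].
have [f [bf cf fa]] := cycle_trans a1 a2; have [h [bh ch hb]] := cycle_trans b1 b2.
have fi := bij_inj bf; have hi := bij_inj bh.
exists (fun y => (f y.1, h y.2)); split.
- by apply: injF_bij => -[x y] [x' y'] /= [] /fi -> /hi ->.
- by move=> x y; rewrite /slice_rel /= !xpair_eqE /= !(inj_eq fi) !(inj_eq hi) cf ch -xpair_eqE -!surjective_pairing.
- by rewrite /= fa hb.
Qed.

Section TorusBound.
Variables (R : realFieldType) (L K N : nat) (L3 : (2 < L)%N) (LN : (L = 2 * N)%N).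
Hypothesis sideK : is_side K.
Variable r : nat.
Hypotheses (r0 : (0 < r)%N) (rN : (4 * r <= N)%N).
Notation V := (vertex L K).
Notation Y := ('I_L * 'I_K)%type.
Notation st := (@slab_torus L K).
Notation sr := (@slice_rel L K).
Notation ch := (@chain Y sr L).
Notation cycL := (cyc L3).
Notation D := ((nmatch st setT)%:R : R).

Lemma ch_sym : symmetric ch. Proof. by apply: chain_sym; apply: slice_sym. Qed.
Lemma ch_irr : irreflexive ch. Proof. by apply: (chain_irr (@slice_irr L K)). Qed.

Lemma nmatch_split (W : {set V}) : nmatch ch (@split1 L K @: W) = nmatch st W.
Proof.
apply: (nmatch_iso (@slab_sym L K) (@slab_irr L K) ch_sym ch_irr (split1_bij L K)).
exact: split1_iso.
Qed.

Lemma nmatch_splitT : nmatch ch setT = nmatch st setT.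
Proof.
rewrite -nmatch_split; congr nmatch; apply/setP => z; have [k hk kh] := split1_bij L K.
by rewrite -(kh z) (mem_imset _ _ (bij_inj (split1_bij L K))) !inE.
Qed.

Lemma nmatch_split2 (o x : V) : nmatch st (~: [set o; x]) = nmatch ch (~: [set split1 o; split1 x]).
Proof.
rewrite -nmatch_split; congr nmatch; apply/setP => z; have [k hk kh] := split1_bij L K.
have ai := bij_inj (split1_bij L K).
by rewrite -(kh z) (mem_imset _ _ ai) !inE !(inj_eq ai).
Qed.

(** The restriction of the staggered cone to the plane through its centre, at the
    position of the crossing edges. *)
Definition stag (y : Y) : R := (-1) ^+ (y.1 + y.2) * cone R r 0 y.1./2.

Lemma moment_le : moment sr L stag <= 24 * K%:R / harm R r * D.
Proof.
have N0 : (0 < N)%N by lia.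
pose z0 := Ordinal N0.
have hm : (2 * (2 * r) <= N)%N by lia.
have := flux_moment L3 LN sideK (erefl : z0 = 0%N :> nat) hm (cone_out R r0).
have n1 := @cone_energy1 R r r0 N rN z0 erefl.
have n2' := @cone_energy2 R r r0 N rN.
rewrite -(link_moment (@slice_sym L K) (@slice_irr L K) LN L3 stag).
move=> h; apply: (@le_trans _ _ (6 * K%:R * (energy1 (cone R r) z0 + energy2 N (cone R r)) * D)); last first.
  rewrite ler_wpM2r ?ler0n //.
  have -> : 24 * K%:R / harm R r = 6 * K%:R * (2 / harm R r + 2 / harm R r) by ring.
  by apply: ler_wpM2l; [rewrite mulr_ge0 ?ler0n|apply: lerD].
apply: le_trans h; rewrite le_eqVlt; apply/orP; left; apply/eqP.
pose ed (y : Y) : {set V} := [set ((cycL L.-1, y.1), y.2); ((cycL 0, y.1), y.2)].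
have hed y : @split1 L K @: ed y = link L3 y.
  by rewrite /ed /link imsetU1 imset_set1; case: y.
have eed y : ed y \in edge_set st.
  apply: (iso_edge (split1_bij L K) (@split1_iso L K L3)); rewrite hed.
  exact: (link_edge sr LN).
rewrite (eq_bigr (fun M : {set {set 'I_L * Y}} => (\sum_y stag y * (@split1 L K @: ed y \in M)%:R) ^+ 2)); last first.
  by move=> M _; congr (_ ^+ 2); apply: eq_bigr => y _; rewrite hed.
rewrite -(second_moment_iso (@slab_sym L K) (@slab_irr L K) ch_sym ch_irr (split1_bij L K) (@split1_iso L K L3) stag eed).
apply: eq_bigr => M _; congr (_ ^+ 2).
rewrite -(pair_bigA _ (fun u w => stag (u, w) * (ed (u, w) \in M)%:R)) /=.
have sp := @sum_cyc_pairs R L N L3 LN.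
rewrite sp /flux; apply: eq_bigr => i _; rewrite -big_split; apply: eq_bigr => w _; rewrite -[LHS]/(_ + _).
have se : stag (cycL (2 * i), w) = (-1) ^+ w * cone R r 0 i.
  by rewrite /stag (cyc_even L3 LN) half_even exprD sgn_even mul1r.
have so : stag (cycL (2 * i).+1, w) = - ((-1) ^+ w * cone R r 0 i).
  by rewrite /stag (cyc_odd L3 LN) half_odd exprD sgn_odd mulN1r mulNr.
rewrite se so.
have E u : ed (u, w) = edge1 L3 u (z0, w).
  by rewrite /ed /edge1 /= -(ord_pred_0 L3).
rewrite !E /occ. ring.
Qed.

(** One monomer sits at the centre [2 * r] of the bump, where [stag] is 1 in absolute
    value.  The other one is at a zero of [stag] unless its column is among the first
    [4 * r], where the trivial bound is used. *)
Lemma torus_moment_bound (o : V) lam : 0 < lam ->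
  \sum_x (nmatch st (~: [set o; x]))%:R <=
  (L * K + L * (4 * r * K))%N%:R * D +
  (L * (L * K))%N%:R * ((lam * (24 * K%:R / harm R r) + lam^-1) * D) :> R.
Proof.
move=> l0; have L0 : (0 < L)%N by lia.
have -> : \sum_x (nmatch st (~: [set o; x]))%:R = \sum_z (nmatch ch (~: [set split1 o; z]))%:R :> R.
  rewrite (reindex (@split1 L K)) /=; last by apply: onW_bij; apply: split1_bij.
  by apply: eq_bigr => x _; rewrite nmatch_split2.
pose y0 : Y := (cycL (2 * r), o.2).
have cs := @slice_sym L K; have ci := @slice_irr L K.
have -> : split1 o = (o.1.1, (o.1.2, o.2)) by [].
apply: (le_trans (averaging R cs ci LN L3 (@slice_trans L K) _ _ y0)).
rewrite card_prod !card_ord nmatch_splitT natrD mulrDl -addrA lerD2l.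
have n0 : cycL (2 * r) = (2 * r)%N :> nat by rewrite /= modn_small //; lia.
have s0 : `|stag y0| = 1.
  rewrite /stag n0 half_even normrM normrX normrN1 expr1n mul1r.
  by rewrite /cone /offset subnn addn0 maxnn profile0 // normr1.
have one y : (nmatch ch (~: [set (cycL L.-1, y0); (cycL 0, y)]))%:R <=
   (y.1 < 4 * r)%N%:R * D + (lam * (24 * K%:R / harm R r) + lam^-1) * D.
  have hh := harm_gt0 R r0.
  have q0 : 0 <= (lam * (24 * K%:R / harm R r) + lam^-1) * D.
    have q1 : 0 <= 24 * K%:R / harm R r by rewrite divr_ge0 ?mulr_ge0 ?ler0n // ltW.
    by rewrite mulr_ge0 ?ler0n // addr_ge0 ?invr_ge0 ?(ltW l0) // mulr_ge0 // ltW.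
  case: ltnP => hy.
    by rewrite mul1r -nmatch_splitT; apply: ler_wpDr; [rewrite nmatch_splitT|apply: (adjacent_slice_le R cs ci LN L3)].
  rewrite mul0r add0r -(cyc_last LN) pair_set (nmatch_adjacent R cs ci LN L3).
  have hi : (2 * r <= y.1./2)%N by move: hy; move: (nat_of_ord y.1) => k; lia.
  have sy : stag y = 0 by rewrite /stag cone_out ?mulr0 // hi orbT.
  have ny : y0 != y.
    by apply: contraTneq hy => <-; rewrite -ltnNge n0; lia.
  have hs : `|stag y - stag y0| = 1 by rewrite sy sub0r normrN.
  apply: (le_trans (tr_pair_moment cs ci LN L3 l0 ny hs)).
  rewrite nmatch_splitT mulrDl lerD2r -mulrA ler_wpM2l ?(ltW l0) //.
  exact: moment_le.
have : \sum_y (nmatch ch (~: [set (cycL L.-1, y0); (cycL 0, y)]))%:R <=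
   (4 * r * K)%N%:R * D + (L * K)%N%:R * ((lam * (24 * K%:R / harm R r) + lam^-1) * D).
  apply: (le_trans (ler_sum _ (fun y _ => one y))).
  rewrite big_split /= sumr_const card_prod !card_ord -[X in _ + X <= _]mulr_natl.
  rewrite lerD2r -mulr_suml ler_wpM2r ?ler0n //.
  rewrite -(pair_bigA _ (fun (u : 'I_L) (w : 'I_K) => (u < 4 * r)%N%:R)) /=.
  rewrite exchange_big /= sumr_const card_ord natrM -[X in X <= _]mulr_natr ler_wpM2r ?ler0n //.
  have hP i : (i < 4 * r)%N -> (0 <= i < 4 * r)%N by lia.
  by apply: (le_trans (sum_indicator_le R L hP)); rewrite subn0.
move=> h; have := ler_wpM2l (ler0n R L) h.
by rewrite mulrDr !mulrA -!natrM.
Qed.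

Lemma torus_trivial_bound (o : V) :
  \sum_x (nmatch st (~: [set o; x]))%:R <= (L * K + L * (L * K))%N%:R * D :> R.
Proof.
have -> : \sum_x (nmatch st (~: [set o; x]))%:R = \sum_z (nmatch ch (~: [set split1 o; z]))%:R :> R.
  rewrite (reindex (@split1 L K)) /=; last by apply: onW_bij; apply: split1_bij.
  by apply: eq_bigr => x _; rewrite nmatch_split2.
have cs := @slice_sym L K; have ci := @slice_irr L K.
have -> : split1 o = (o.1.1, (o.1.2, o.2)) by [].
apply: (le_trans (averaging R cs ci LN L3 (@slice_trans L K) _ _ (o.1.2, o.2))).
rewrite card_prod !card_ord nmatch_splitT natrD mulrDl lerD2l natrM -mulrA ler_wpM2l ?ler0n //.
have -> : (L * K)%N%:R * D = \sum_(y : Y) D by rewrite sumr_const card_prod !card_ord mulr_natl.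
by apply: ler_sum => y _; rewrite -nmatch_splitT; apply: (adjacent_slice_le R cs ci LN L3).
Qed.

End TorusBound.

Lemma nat_sqrt n : exists r, (r * r <= n < r.+1 * r.+1)%N.
Proof.
elim: n => [|n [r /andP[h1 h2]]]; first by exists 0%N.
have [h|h] := ltnP n.+1 (r.+1 * r.+1)%N; first by exists r; rewrite h andbT; lia.
by exists r.+1; rewrite h /=; nia.
Qed.

(** The radius of the cone is about the square root of the size of the torus: large
    enough for its logarithm to be comparable to [ln L], small enough for the trivial bound
    on its support to be negligible. *)
Lemma large_sqrt N : (16 <= N)%N ->
  exists r, [/\ (4 <= r)%N, (4 * r <= N)%N, (r * r <= N)%N & (2 * N <= r.+1 ^ 4)%N].
Proof.
move=> hN; have [r /andP[r1 r2]] := nat_sqrt N; exists r.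
have r4 : (4 <= r)%N by rewrite leqNgt; apply/negP => h; have := leq_mul h h; lia.
have r5 : (4 * r <= r * r)%N by rewrite leq_mul2r r4 orbT.
split=> //; first by apply: leq_trans r5 r1.
rewrite (expnM _ 2 2) -mulnn; apply: leq_mul; first by rewrite -mulnn; nia.
by rewrite -mulnn; apply: ltnW.
Qed.

Lemma sum_corr (R : realFieldType) L K (o : vertex L K) :
  \sum_x monomer_corr R (@slab_torus L K) o x / #|vertex L K|%:R =
  (\sum_x (nmatch (@slab_torus L K) (~: [set o; x]))%:R) /
  ((nmatch (@slab_torus L K) setT)%:R * (L * (L * K))%N%:R).
Proof.
rewrite invfM mulrA mulr_suml mulr_suml; apply: eq_bigr => x _.
rewrite /monomer_corr !card_prod !card_ord mulnA; congr (_%:R / _%:R * _).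
  by rewrite /nmatch /matchings -lock setCK.
have E : [set f in edge_set (@slab_torus L K) | [disjoint f & set0]] = edge_set (@slab_torus L K).
  by apply/setP => f; rewrite inE -setI_eq0 setI0 eqxx andbT.
by rewrite /nmatch /matchings -lock setCT /dimers_off setC0 E.
Qed.

Lemma is_side_even L : is_side L -> (1 < L)%N -> exists N, (L = 2 * N)%N.
Proof. by rewrite /is_side => h1 h2; exists L./2; lia. Qed.

From mathcomp Require Import all_classical all_reals all_analysis.

Lemma ln_le_harm (R : realType) r : ln r.+1%:R <= harm R r.
Proof.
elim: r => [|r IH]; first by rewrite /harm big_ord0 ln1.
rewrite /harm big_ord_recr /= -/(harm R r).
have -> : r.+2%:R = r.+1%:R * (1 + r.+1%:R^-1) :> R.
  by rewrite mulrDr mulr1 divff ?pnatr_eq0 // natr1.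
have p1 : 0 < r.+1%:R :> R by rewrite ltr0n.
have p2 : 0 < r.+1%:R^-1 :> R by rewrite invr_gt0.
rewrite lnM ?posrE; [|done|by rewrite addr_gt0].
by apply: lerD => //; apply: le_ln1Dx; apply: lt_trans p2; rewrite ltrN10.
Qed.

(** Excludes [L = 2], for which the slab would have too few slices. *)
Lemma ln2_lt1 (R : realType) : ln 2 < 1 :> R.
Proof.
have -> : 2 = (1 + 3^-1) * (1 + 2^-1) :> R by field.
rewrite lnM ?posrE; [|lra|lra].
have h1 : ln (1 + 3^-1) <= 3^-1 :> R by apply: le_ln1Dx; lra.
have h2 : ln (1 + 2^-1) <= 2^-1 :> R by apply: le_ln1Dx; lra.
lra.
Qed.

Theorem theorem1p1 (R : realType) :
  exists c : R, forall (L K : nat) (hL : is_side L) (hK : is_side K),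
    K%:R <= Num.sqrt (ln (L%:R : R)) ->
    \sum_(x : vertex L K)
       monomer_corr R (@slab_torus L K) (origin hL hK) x / #|vertex L K|%:R
    <= c * Num.sqrt (K%:R / ln (L%:R : R)).
Proof.
exists 107 => L K hL hK hKL.
have K1 : (0 < K)%N by move: hK; rewrite /is_side; lia.
have K1R : 1 <= K%:R :> R by rewrite ler1n.
set l := ln (L%:R : R) in hKL *.
(* The hypothesis gives [1 <= K <= Num.sqrt l]. *)
have l1 : 1 <= l.
  have s1 : 1 <= Num.sqrt l by apply: le_trans hKL.
  have l0 : 0 <= l by case: (leP 0 l) s1 => // /ltW/ler0_sqrtr ->; rewrite ler10.
  by rewrite -(sqr_sqrtr l0) expr_ge1 // sqrtr_ge0.
have l0 : 0 < l by apply: lt_le_trans l1.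
have L3 : (2 < L)%N.
  rewrite ltnNge; apply/negP => L2; have := ln2_lt1 R; apply/negP; rewrite -leNgt.
  apply: (le_trans l1); rewrite /l; have [->|Lpos] := posnP L; first by rewrite ln0 // ln_ge0 // ler1n.
  by rewrite ler_ln ?posrE ?ltr0n // ler_nat.
have [N LN] : exists N, (L = 2 * N)%N by apply: is_side_even => //; apply: ltn_trans L3.
set x := Num.sqrt _.
have x2 : x ^+ 2 = K%:R / l by rewrite sqr_sqrtr // divr_ge0 // ltW.
have x0 : 0 < x by rewrite sqrtr_gt0 divr_gt0 // (lt_le_trans ltr01).
have lx : 1 <= x * l.
  rewrite -(@ler_pXn2r _ 2) ?nnegrE ?mulr_ge0 ?(ltW x0) ?(ltW l0) // expr1n exprMn x2.
  have -> : K%:R / l * l ^+ 2 = K%:R * l by field; rewrite gt_eqF.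
  by rewrite -[leLHS]mul1r ler_pM.
rewrite sum_corr; set D := (nmatch _ _)%:R.
have [D0|Dn0] := eqVneq D 0.
  by rewrite D0 mul0r invr0 mulr0 mulr_ge0 // ltW.
have Dp : 0 < D by rewrite lt_def Dn0 ler0n.
have Vp : 0 < (L * (L * K))%N%:R :> R by rewrite ltr0n !muln_gt0 K1; lia.
rewrite ler_pdivrMr ?mulr_gt0 //.
have LKR : (L * (L * K))%N%:R = L%:R * (L%:R * K%:R) :> R by rewrite !natrM.
have LR : 0 < L%:R :> R by rewrite ltr0n; lia.
(* The trivial bound makes the average at most 2, and [x] is at least 1 / 32. *)
have [N16|N16] := ltnP N 16.
  apply: (le_trans (torus_trivial_bound R L3 LN _)); rewrite -/D.
  rewrite mulrCA mulrC ler_pM2l //.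
  have h : (L * K + L * (L * K))%N%:R <= 2 * (L * (L * K))%N%:R :> R.
    by rewrite -natrM ler_nat mul2n -addnn leq_add2r leq_mul // leq_pmull //; lia.
  apply: (le_trans h); rewrite ler_pM2r //.
  have lL : l < L%:R by apply: ln_sublinear.
  have L32 : L%:R <= 32 :> R.
    have L32 : (L <= 32)%N by clear -LN N16; lia.
    by rewrite ler_nat.
  have : x * l <= x * 32 by rewrite ler_pM2l //; lra.
  lra.
have [r [r4 rN r1 r2]] := large_sqrt N16.
have r0 : (0 < r)%N by apply: leq_trans r4.
have rR : 4 <= r%:R :> R by rewrite ler_nat.
have xi0 : 0 < x^-1 by rewrite invr_gt0.
(* The two terms lam * moment + 1 / lam are balanced at lam = 1 / x. *)
apply: (le_trans (torus_moment_bound L3 LN hK r0 rN _ xi0)); rewrite -/D invrK.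
have hl : l <= 4 * ln (r.+1%:R).
  have p1 : 0 < r.+1%:R :> R by rewrite ltr0n.
  have p4 : 0 < r.+1%:R ^+ 4 :> R by rewrite exprn_gt0.
  rewrite mulr_natl -lnXn // /l ler_ln ?posrE //.
  by rewrite -natrX ler_nat LN.
have hh : l <= 4 * harm R r by apply: (le_trans hl); rewrite ler_pM2l // ln_le_harm.
have lr : l <= 4 * r%:R.
  by apply: (le_trans hl); rewrite ler_pM2l // -nat1r le_ln1Dx //; lra.
have hp := harm_gt0 R r0.
have h1 : x^-1 * (24 * K%:R / harm R r) <= 96 * x.
  have -> : K%:R = x ^+ 2 * l by rewrite x2 divfK // gt_eqF.
  have -> : x^-1 * (24 * (x ^+ 2 * l) / harm R r) = 24 * x * (l / harm R r).
    by field; rewrite !gt_eqF.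
  have -> : 96 * x = 24 * x * 4 by ring.
  by rewrite ler_pM2l ?mulr_gt0 // ler_pdivrMr.
have h2 : 1 + 4 * r%:R <= 10 * x * L%:R.
  have a1 : 1 <= x * (4 * r%:R) by apply: (le_trans lx); rewrite ler_pM2l.
  have a2 : 2 * (r%:R * r%:R) <= L%:R :> R by rewrite -!natrM ler_nat LN leq_mul2l.
  have a3 : 10 * x * (2 * (r%:R * r%:R)) <= 10 * x * L%:R by rewrite ler_pM2l ?mulr_gt0.
  have a4 : 5 * r%:R <= 5 * r%:R * (x * (4 * r%:R)) by rewrite ler_peMr //; lra.
  apply: le_trans a3; have -> : 10 * x * (2 * (r%:R * r%:R)) = 5 * r%:R * (x * (4 * r%:R)) by ring.
  apply: le_trans a4; lra.
have LK0 : 0 <= D * (L%:R * K%:R) by rewrite !mulr_ge0 // ltW.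
have LLK0 : 0 <= D * (L%:R * (L%:R * K%:R)) by rewrite !mulr_ge0 // ltW.
have b1 := ler_wpM2l LK0 h2.
have b2 := ler_wpM2l LLK0 h1.
rewrite LKR natrD !natrM; move: (24 * K%:R / harm R r) b2 => z b2.
move: b1 b2 => {h1 h2 lx lr hh hl LLK0 LK0}; set y := x^-1; move: (L%:R : R) (K%:R : R) (r%:R : R) => L' K' r'.
move=> b1 b2; rewrite -subr_ge0.
have -> : 107 * x * (D * (L' * (L' * K'))) - ((L' * K' + L' * (4 * r' * K')) * D + L' * (L' * K') * ((y * z + x) * D)) =
  (D * (L' * K') * (10 * x * L') - D * (L' * K') * (1 + 4 * r')) +
  (D * (L' * (L' * K')) * (96 * x) - D * (L' * (L' * K')) * (y * z)) by ring.
by rewrite addr_ge0 // subr_ge0.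
Qed.
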